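(* Let $F$ be a perfect idyll. Then $K_0(F\text{-}\mathbf{Mat}_\bullet)\cong\mathbb Z\oplus\mathbb Z$.
   Context: **Idylls.** A pointed monoid is a commutative multiplicative monoid $B=B'\sqcup\{0\}$ with $B'$ a submonoid and $0$ absorbing. Its ambient semiring is $B^+=\mathbb N[B]/\langle 0\rangle$ (finite formal sums of elements of $B$, with $0\in B$ identified with the empty sum). A band is a pointed monoid $B$ with a null set $N_B$, a proper ideal of $B^+$ with $0\in N_B$, such that for every $a\in B$ there is a unique $b\in B$, denoted $-a$, with $a+b\in N_B$. An idyll is a band $F$ with $F^\times=F\setminus\{0\}$. **$F$-matroids.** For a tuple $\mathbf x$, $|\mathbf x|$ is its set of entries and $\mathbf x_{\hat k}$ is $\mathbf x$ with the $k$th entry deleted. A Grassmann–Plücker function of rank $r$ on a finite set $E$ is a map $\mu:E^r\to F$ that is not identically zero ($E^0$ is a one-point set), is alternating ($\mu(\mathbf x^\sigma)=\mathrm{sign}(\sigma)\mu(\mathbf x)$ for $\sigma\in S_r$, and $\mu(\mathbf x)=0$ if $\mathbf x$ has a repeated entry), and satisfies $\sum_{k=0}^r(-1)^k\mu(\mathbf x_{\hat k})\mu(x_k,\mathbf y)\in N_F$ for all $\mathbf x=(x_0,\dots,x_r)\in E^{r+1}$, $\mathbf y\in E^{r-1}$. An $F$-matroid of rank $r$ on $E$ is a class $M=[\mu]$ of such functions up to scaling by $F^\times$. Its underlying matroid $\underline M$ has as bases the sets $\{e_1,\dots,e_r\}$ with $\mu(e_1,\dots,e_r)\ne0$. A pointed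 $F$-matroid is an $F$-matroid on a pointed finite set $E_M=\tilde E_M\sqcup\{*_M\}$ with $\mu(\mathbf x)=0$ whenever some $x_i=*_M$. **Duals, vectors, perfect idylls.** For $M=[\mu]$ of rank $r$ on a totally ordered set $E$ with $n$ elements, $M^*=[\mu^*]$, where $\mu^*:E^{n-r}\to F$ is $0$ on tuples with repeated entries and otherwise $\mu^*(\mathbf x)=\mathrm{sign}(\mathbf x,\mathbf x')\mu(\mathbf x')$, with $|\mathbf x'|=E\setminus|\mathbf x|$ and $\mathrm{sign}$ the sign of the permutation of $E$ given by $(\mathbf x,\mathbf x')$. For $X,Y\in F^E$ write $X\perp Y$ if $\sum_eX_eY_e\in N_F$; $A^\perp$ is the set of vectors orthogonal to all of $A\subseteq F^E$. Circuits of $M$ are the vectors $aX_{\mathbf y}$, $a\in F^\times$, where $\mathbf y=(y_0,\dots,y_r)$ has distinct entries and some $\mu(\mathbf y_{\hat i})\neq0$, with $X_{\mathbf y}(y_k)=(-1)^k\mu(\mathbf y_{\hat k})$ and $X_{\mathbf y}(x)=0$ for $x\notin|\mathbf y|$. Let $\mathcal C_M$ be the set of circuits, $\mathcal C_M^*=\mathcal C_{M^*}$, $\mathcal V_M=(\mathcal C_M^* )^\perp$ (vectors), $\mathcal V_M^*=\mathcal C_M^\perp$ (covectors). $F$ is perfect if $\mathcal V_M\perp\mathcal V_M^*$ for all $F$-matroids $M$. For pointed $M$, $\mathcal V_M\subseteq F^{\tilde E_M}$ denotes the vectors of the $F$-matroid obtained by deleting $*_M$. **Category $F\text{-}\mathbf{Mat}_\bullet$.**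 Objects are pointed $F$-matroids. A submonomial matrix is a matrix over $F$ with at most one nonzero entry in each row and column. A morphism $f:M\to N$ is a submonomial matrix with rows indexed by $\tilde E_N$, columns by $\tilde E_M$, such that $f\cdot\mathcal V_M\subseteq\mathcal V_N$. Composition is matrix multiplication. The zero object is the matroid on $\{*\}$. **Exact sequences and $K_0$.** For $A\subseteq\tilde E_M$ of rank $r'$ in $\underline M$: $M/A=[\mu/A]$ on $E_M\setminus A$, $(\mu/A)(\mathbf x)=\mu(\mathbf x,\mathbf a)$ with $\mathbf a\in A^{r'}$ an ordered basis of $\underline M|A$; $M|A=[\mu|A]$ on $A\sqcup\{*_M\}$, $(\mu|A)(\mathbf x)=\mu(\mathbf x,\mathbf c)$ with $\mathbf c$ an ordered basis of $\underline M/A$. The morphisms $M|A\to M$, $M\to M/A$ have entries $\delta_{ij}$. In the proto-exact structure on $F\text{-}\mathbf{Mat}_\bullet$, admissible monomorphisms are restrictions $M|A\to M$ precomposed with isomorphisms and admissible epimorphisms are contractions $M\to M/A$ postcomposed with isomorphisms; short exact sequences are, up to isomorphism, the sequences $M|A\rightarrowtail M\twoheadrightarrow M/A$. $K_0$ is the Grothendieck group: the abelian group generated by isomorphism classes of objects with a relation $[X]=[U]+[V]$ for each short exact sequence $U\rightarrowtail X\twoheadrightarrow V$. *)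

(* Defs.v *)
From HB Require Import structures.
From mathcomp Require Import all_boot all_fingroup all_algebra.
From mathcomp Require Import boolp.
From mathcomp.multinomials Require Import freeg.

Set Implicit Arguments.
Unset Strict Implicit.
Unset Printing Implicit Defensive.

Local Open Scope group_scope.

HB.mixin Record isPointedMonoid B of Choice B & Monoid B := {
  zerob : B;
  mulbC : commutative (@monoid.mul B);
  mul0b : forall a : B, zerob * a = zerob;
  oneb_neq0 : 1 != zerob;
  mulb_neq0 : forall a b : B, a != zerob -> b != zerob -> a * b != zerob
}.

#[short(type="pointedMonoidType")]
HB.structure Definition PointedMonoid :=
  {B of isPointedMonoid B & Choice B & Monoid B}.

(* An element of the ambient semiring B^+ = N[B]/<0> is written as the list of
   its summands; [fsum_eq] is the equality of B^+, the list concatenation is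
   its sum and [allpairs] its product. *)
Definition fsum_eq (B : pointedMonoidType) (s t : seq B) : bool :=
  perm_eq [seq a <- s | a != zerob] [seq a <- t | a != zerob].

(* [null] is the null set, a proper ideal of B^+, and [oppb a] is the unique b
   such that a + b is null. *)
HB.mixin Record isBand B of PointedMonoid B := {
  null : seq B -> Prop;
  null_eq : forall s t : seq B, fsum_eq s t -> null s -> null t;
  null0 : null [::];
  nullD : forall s t, null s -> null t -> null (s ++ t);
  nullM : forall s t, null t -> null [seq a * b | a <- s, b <- t];
  null_proper : exists s, ~ null s;
  oppb : B -> B;
  oppbP : forall a b, null [:: a; b] <-> b = oppb a
}.

#[short(type="bandType")]
HB.structure Definition Band := {B of isBand B & PointedMonoid B}.

(* The other inclusion, B^x \subset B \ {0}, holds in every pointed monoid. *)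
HB.mixin Record isIdyll B of Band B := {
  idyll_unit : forall a : B, a != zerob -> exists b, a * b = 1
}.

#[short(type="idyllType")]
HB.structure Definition Idyll := {B of isIdyll B & Band B}.

(* (-1)^n; for a permutation s, coerced to its parity, [sgn s] is sign(s). *)
Definition sgn (F : idyllType) (n : nat) : F := oppb 1 ^+ n.

Lemma mulb0 (B : pointedMonoidType) (a : B) : a * zerob = zerob.
Proof. by rewrite mulbC mul0b. Qed.

Lemma mulb_eq0 (B : pointedMonoidType) (a b : B) :
  (a * b == zerob) = (a == zerob) || (b == zerob).
Proof.
have [->|a0] := eqVneq a zerob; first by rewrite mul0b eqxx.
have [->|b0] := eqVneq b zerob; first by rewrite mulb0 eqxx.
by rewrite (negPf (mulb_neq0 a b a0 b0)).
Qed.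

Lemma oppb1_neq0 (B : bandType) : oppb 1 != zerob :> B.
Proof.
apply/eqP => o0; have [s] := @null_proper B; apply.
have n1 : null [:: 1 : B].
  apply: null_eq (_ : null [:: 1; zerob]); last exact/oppbP.
  by rewrite /fsum_eq /= eqxx /=.
have := nullM s _ n1.
suff -> : [seq a * b | a <- s, b <- [:: 1]] = s by [].
by elim: s => //= a s ->; rewrite mulg1.
Qed.

Lemma sgn_neq0 (F : idyllType) n : sgn F n != zerob.
Proof.
elim: n => [|n IHn]; first exact: oneb_neq0.
by rewrite /sgn expgS mulb_neq0 // oppb1_neq0.
Qed.

Definition del (E : Type) (k : nat) (x : seq E) : seq E :=
  take k x ++ drop k.+1 x.

(* A map E^r -> F is encoded by its extension by zero to all words over E.
   For r = 0 there is no y in E^(r-1), hence no condition [gp_rel]. *)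
Record gp_function (F : idyllType) (E : finType) (r : nat) (mu : seq E -> F)
    : Prop := GPFunction {
  gp_size : forall x, mu x != zerob -> size x = r;
  gp_neq0 : exists x, mu x != zerob;
  gp_perm : forall (x : r.-tuple E) (s : 'S_r),
    mu [seq tnth x (s i) | i <- enum 'I_r] = sgn F s * mu x;
  gp_rep : forall x, ~~ uniq x -> mu x = zerob;
  gp_rel : forall (x : r.+1.-tuple E) (y : seq E), (size y).+1 = r ->
    null [seq sgn F k * (mu (del k x) * mu (tnth x k :: y))
         | k : 'I_r.+1 <- enum 'I_r.+1]
}.

Definition scaling_class (F : idyllType) (E : Type) (mu : seq E -> F)
    (nu : seq E -> F) : Prop :=
  exists2 a : F, a != zerob & nu = (fun x => a * mu x).

Record fmatroid (F : idyllType) (E : finType) := FMatroid {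
  frank : nat;
  fclass : (seq E -> F) -> Prop;
  fclassP : exists2 mu, gp_function frank mu & fclass = scaling_class mu
}.

Section Matroid.
Variables (F : idyllType) (E : finType).
Implicit Types (M : fmatroid F E) (A B C I : {set E}) (r : nat).

Definition gp_matroid r (mu : seq E -> F) (mu_gp : gp_function r mu) :
  fmatroid F E := FMatroid (ex_intro2 _ _ mu mu_gp erefl).

(* A representative of the class M; the notions defined below through it
   do not depend on its choice. *)
Definition gp M : seq E -> F := s2val (cid2 (fclassP M)).

Lemma gpP M : gp_function (frank M) (gp M).
Proof. by rewrite /gp; case: cid2. Qed.

Lemma fclassE M : fclass M = scaling_class (gp M).
Proof. by rewrite /gp; case: cid2. Qed.

Lemma gp_matroidE r mu (mu_gp : gp_function r mu) :
  exists2 a : F, a != zerob & gp (gp_matroid mu_gp) = (fun x => a * mu x).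
Proof.
have := fclassE (gp_matroid mu_gp) => /(congr1 (fun P => P (gp _))) /=.
set nu := gp _ => eP.
suff: scaling_class nu nu by rewrite -eP.
exists 1; first exact: oneb_neq0.
by apply/funext => x; rewrite mul1g.
Qed.

Definition basis M B : bool :=
  [exists e : (frank M).-tuple E, (B == [set:: e]) && (gp M e != zerob)].

Definition mrank M A : nat := \max_(B : {set E} | basis M B) #|A :&: B|.

Definition basis_restr M A I : bool :=
  [exists B, [&& basis M B, I == A :&: B & #|I| == mrank M A]].

Definition basis_contr M A C : bool :=
  [exists I, [&& basis_restr M A I, [disjoint C & A] & basis M (C :|: I)]].

Definition ordered_basis (P : pred {set E}) (a : seq E) : bool :=
  uniq a && P [set:: a].

Lemma ex_basis M : exists B, basis M B.
Proof.
have [x x0] := gp_neq0 (gpP M).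
have xr : size x == frank M by apply/eqP/(gp_size (gpP M)).
by exists [set:: x]; apply/existsP; exists (Tuple xr); rewrite eqxx.
Qed.

Lemma ex_basis_restr M A : exists I, basis_restr M A I.
Proof.
have [B0 B0P] := ex_basis M.
have [B BP rE] : exists2 B, basis M B & #|A :&: B| = mrank M A.
  rewrite /mrank; have := @eq_bigmax_cond _ (basis M) (fun B => #|A :&: B|).
  case; last by move=> B BP ->; exists B.
  by apply/card_gt0P; exists B0.
by exists (A :&: B); apply/existsP; exists B; rewrite BP rE !eqxx.
Qed.

Lemma ex_basis_contr M A : exists C, basis_contr M A C.
Proof.
have [I IP] := ex_basis_restr M A; have /existsP [B /and3P[BP /eqP IE _]] := IP.
exists (B :\: A); apply/existsP; exists I; rewrite IP IE setIC setUC setID BP.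
by rewrite -setI_eq0 setDE -setIA [_ :&: A]setIC setICr setI0 eqxx.
Qed.

Lemma ex_ordered_basis (P : pred {set E}) :
  (exists B, P B) -> exists a, ordered_basis P a.
Proof.
case=> B PB; exists (enum B); rewrite /ordered_basis enum_uniq.
suff -> : [set:: enum B] = B by [].
by apply/setP => e; rewrite inE mem_enum.
Qed.

Definition obasis_restr M A : seq E :=
  xchoose (ex_ordered_basis (ex_basis_restr M A)).

Definition obasis_contr M A : seq E :=
  xchoose (ex_ordered_basis (ex_basis_contr M A)).

Definition perp (X Y : E -> F) : Prop := null [seq X e * Y e | e <- enum E].

Definition orth (S : (E -> F) -> Prop) (X : E -> F) : Prop :=
  forall Y, S Y -> perp X Y.

(* The permutation sending the i-th element of E to the i-th entry of x, when
   the word x enumerates E without repetition; E is ordered by [enum E]. *)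
Definition word_perm (x : seq E) : {perm E} :=
  insubd (1 : {perm E}) [ffun e => nth e x (enum_rank e)].

Definition compl_word (x : seq E) : seq E := [seq e <- enum E | e \notin x].

(* If mu has rank r, then [dual mu x] is zero unless size x = #|E| - r. *)
Definition dual (mu : seq E -> F) (x : seq E) : F :=
  if uniq x then sgn F (word_perm (x ++ compl_word x)) * mu (compl_word x)
  else zerob.

Definition circuit r (mu : seq E -> F) (X : E -> F) : Prop :=
  exists (a : F) (y : r.+1.-tuple E),
    [/\ a != zerob, uniq y, exists k : 'I_r.+1, mu (del k y) != zerob,
        forall k : 'I_r.+1, X (tnth y k) = a * (sgn F k * mu (del k y))
      & forall e, e \notin y -> X e = zerob].

Definition circuits M := circuit (frank M) (gp M).

Definition cocircuits M := circuit (#|E| - frank M) (dual (gp M)).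

Definition vectors M := orth (cocircuits M).

Definition covectors M := orth (circuits M).

End Matroid.

Definition perfect (F : idyllType) : Prop :=
  forall (E : finType) (M : fmatroid F E) (X Y : E -> F),
    vectors M X -> covectors M Y -> perp X Y.

Section Pull.
Variables (F : idyllType) (E : finType).
Implicit Types (r : nat) (mu : seq E -> F).

Lemma gp_permE r mu x y :
  gp_function r mu -> perm_eq x y -> mu x != zerob -> mu y != zerob.
Proof.
move=> muP; rewrite perm_sym => xy x0; have /eqP xr := gp_size muP x0.
have yr : size y == r by rewrite (perm_size xy).
have /tuple_permP [s yE] : perm_eq (Tuple yr) (Tuple xr) by [].
have /= := gp_perm muP (Tuple xr) s.
rewrite (_ : [seq _ | _ <- _] = y); last by rewrite [RHS]yE /= enumT.
by move->; rewrite mulb_neq0 // sgn_neq0.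
Qed.

Definition alternating r mu := forall (x : r.-tuple E) (s : 'S_r),
  mu [seq tnth x (s i) | i <- enum 'I_r] = sgn F s * mu x.

Lemma alternating_rcons r mu b :
  alternating r.+1 mu -> alternating r (fun x => mu (rcons x b)).
Proof.
move=> muP x s; have := muP [tuple of rcons x b] (lift_perm ord_max ord_max s).
rewrite odd_lift_perm addbb addFb => <-; congr (mu _).
rewrite enum_ordSr map_rcons lift_perm_id; congr rcons.
  rewrite -[RHS]map_comp; apply: eq_map => i /=.
  have -> : widen_ord (leqnSn r) i = fintype.lift ord_max i.
    by apply: val_inj; rewrite /= /bump leqNgt ltn_ord.
  rewrite lift_perm_lift !(tnth_nth b) /= nth_rcons size_tuple.
  have -> : bump r (s i) = s i by rewrite /bump leqNgt ltn_ord.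
  by rewrite ltn_ord.
by rewrite (tnth_nth b) /= nth_rcons size_tuple ltnn eqxx.
Qed.

Lemma alternating_cat r mu a :
  alternating (r + size a) mu -> alternating r (fun x => mu (x ++ a)).
Proof.
elim: a r mu => [|b a IHa] r mu muP.
  by move: muP; rewrite addn0 => muP x s; rewrite !cats0.
move=> x s; rewrite -!cat_rcons.
apply: (@alternating_rcons r (fun x => mu (x ++ a)) b).
by apply: IHa; rewrite addSnnS.
Qed.

Lemma map_enum_ord (T : Type) n (G : 'I_n -> T) (H : nat -> T) :
  (forall k, G k = H k) -> [seq G k | k <- enum 'I_n] = [seq H k | k <- iota 0 n].
Proof. by move=> GH; rewrite -val_enum_ord -map_comp; apply: eq_map. Qed.

Lemma null_cat0 (s t : seq F) :
  all (pred1 zerob) t -> null (s ++ t) -> null s.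
Proof.
move=> t0; apply: null_eq; rewrite /fsum_eq filter_cat.
suff -> : [seq a <- t | a != zerob] = [::] by rewrite cats0.
by apply/eqP; rewrite -[_ == _]negbK -has_filter -all_predC; apply: sub_all t0
  => c /= ->.
Qed.

Lemma gp_pull (E' : finType) (f : E' -> E) r mu (a : seq E) :
  gp_function r mu -> (exists x, mu (map f x ++ a) != zerob) ->
  gp_function (r - size a) (fun x => mu (map f x ++ a)).
Proof.
move=> muP mu_neq0.
have szE x : mu (map f x ++ a) != zerob -> size x = (r - size a)%N.
  by move=> /(gp_size muP) <-; rewrite size_cat size_map addnK.
have ra : ((r - size a) + size a)%N = r.
  have [x x0] := mu_neq0; rewrite -(szE x x0).
  by rewrite -(gp_size muP x0) size_cat size_map.
move: (r - size a)%N ra szE => r0 ra szE.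
split=> //.
- move=> x s.
  have H : alternating r0 (fun x => mu (x ++ a)).
    by apply: alternating_cat; rewrite ra; apply: (gp_perm muP).
  rewrite -(H (map_tuple f x) s) -map_comp; congr (mu (_ ++ _)).
  by apply: eq_map => i /=; rewrite tnth_map.
- move=> x /negP xN; apply: (gp_rep muP); apply/negP => xaU; apply: xN.
  by move: xaU; rewrite cat_uniq => /andP[/map_uniq].
move=> x y yr.
have Xr : size (map f x ++ a) == r.+1.
  by rewrite size_cat size_map size_tuple addSn ra.
have Yr : (size (map f y ++ a)).+1 = r by rewrite size_cat size_map -addSn yr.
have := gp_rel muP (Tuple Xr) Yr.
pose x0 := tnth x ord0.
rewrite (@map_enum_ord _ _ _ (fun k => sgn F k * (mu (del k (map f x ++ a)) *
   mu (nth (f x0) (map f x ++ a) k :: map f y ++ a)))); last first.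
  by move=> k; rewrite (tnth_nth (f x0)).
rewrite (@map_enum_ord _ r0.+1 _ (fun k => sgn F k * (mu (map f (del k x) ++ a) *
   mu (map f (nth x0 x k :: y) ++ a)))); last first.
  by move=> k; rewrite (tnth_nth x0).
rewrite -{1}ra -addSn iotaD map_cat add0n => H.
set s := (X in null X); set u := (X in null (X ++ _)) in H.
have -> : s = u; last first.
  apply: null_cat0 H; apply/allP => _ /mapP[k + ->] /=.
  rewrite mem_iota => /andP[rk kr].
  rewrite [mu (_ :: _)](gp_rep muP) ?mulb0 //=.
  rewrite negb_and mem_cat negb_or nth_cat size_map size_tuple ltnNge rk /=.
  by rewrite mem_nth ?andbF // ltn_subLR.
rewrite /s /u; apply/eq_in_map => k; rewrite mem_iota add0n => /= kr.
rewrite nth_cat size_map size_tuple kr (nth_map x0) ?size_tuple //.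
congr (_ * (mu _ * _)).
rewrite /del take_cat drop_cat size_map size_tuple kr map_cat map_take map_drop.
rewrite -catA; congr (_ ++ _).
case: ltnP => // rk; rewrite (_ : (k.+1 - r0.+1)%N = 0%N); last by apply/eqP.
by rewrite drop0 [X in X ++ _]drop_oversize // size_map size_tuple.
Qed.

End Pull.

(* The pointed ground set is [option pground], with base point [None]. *)
Record pmatroid (F : idyllType) := PMatroid {
  pground : finType;
  pmat : fmatroid F (option pground);
  pmatP : forall x, None \in x -> gp pmat x = zerob
}.

Section PointedMatroid.
Variable F : idyllType.
Implicit Types (M N : pmatroid F).

Lemma gp_somes M x : gp (pmat M) x != zerob -> exists y, x = map Some y.
Proof.
move=> x0; exists (pmap id x).
have : None \notin x by apply: contraNN x0 => /pmatP ->.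
elim: x {x0} => [|[e|] x IHx] //=; rewrite inE => /= /IHx <- //.
Qed.

(* Deletion of the base point, which is a loop. *)
Lemma gp_del_point M : exists x, gp (pmat M) (map Some x ++ [::]) != zerob.
Proof.
have [x x0] := gp_neq0 (gpP (pmat M)).
by have [y yE] := gp_somes x0; exists y; rewrite cats0 -yE.
Qed.

Definition del_point M : fmatroid F (pground M) :=
  gp_matroid (gp_pull (gpP (pmat M)) (gp_del_point M)).

Definition pvectors M : (pground M -> F) -> Prop := vectors (del_point M).

End PointedMatroid.

Arguments pvectors {F} M X.

Definition in_ground (T : finType) (P : pred T) (e : option {x : T | P x}) :
  option T := omap val e.

Section RestrictionContraction.
Variables (F : idyllType) (M : pmatroid F).
Local Notation T := (pground M).
Local Notation mu := (gp (pmat M)).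

Lemma in_ground_onto (P : pred T) (w : seq (option T)) :
  (forall t, Some t \in w -> P t) -> exists x, w = map (@in_ground T P) x.
Proof.
elim: w => [|e w IHw] wP; first by exists [::].
have [x xE] : exists x, w = map (@in_ground T P) x.
  by apply: IHw => t tw; apply: wP; rewrite inE tw orbT.
case: e wP => [t|] wP; last by exists (None :: x); rewrite xE.
have Pt : P t by apply: wP; rewrite mem_head.
by exists (Some (Sub t Pt) :: x); rewrite xE.
Qed.

Lemma gp_enum (I : {set option T}) (a : seq (option T)) : uniq a ->
  [disjoint I & [set:: a]] -> basis (pmat M) (I :|: [set:: a]) ->
  mu (enum I ++ a) != zerob.
Proof.
move=> aU Ia /existsP[e /andP[/eqP eE e0]].
have eU : uniq e by apply: contraNT e0 => /(gp_rep (gpP (pmat M))) ->.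
apply: gp_permE (gpP (pmat M)) _ e0; apply: uniq_perm => //.
  rewrite cat_uniq enum_uniq aU andbT /=; apply/hasPn => t ta.
  rewrite mem_enum; apply: contraTN Ia => tI; apply/pred0Pn.
  by exists t; rewrite /= tI inE.
move=> t; rewrite mem_cat mem_enum; have /setP/(_ t) := eE.
by rewrite !inE => ->.
Qed.

Lemma restr_subproof (A : {set T}) :
  exists x, mu (map (@in_ground T [in A]) x ++
                obasis_contr (pmat M) (Some @: A)) != zerob.
Proof.
rewrite /obasis_contr; set c := xchoose _.
have /andP[cU] : ordered_basis _ c := xchooseP _.
move=> /existsP[I /and3P[/existsP[B /and3P[_ /eqP IE _]] cA]]; rewrite setUC => cI.
have IA : I \subset Some @: A by rewrite IE subsetIl.
have [|x xE] := @in_ground_onto [in A] (enum I).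
  move=> t; rewrite mem_enum => /(subsetP IA) /imsetP[u uA [->]] //.
exists x; rewrite -xE gp_enum //.
by apply: disjointWl IA _; rewrite disjoint_sym.
Qed.

Lemma contr_subproof (A : {set T}) :
  exists x, mu (map (@in_ground T [predC A]) x ++
                obasis_restr (pmat M) (Some @: A)) != zerob.
Proof.
rewrite /obasis_restr; set a := xchoose _.
have /andP[aU] : ordered_basis _ a := xchooseP _.
move=> /existsP[B /and3P[BP /eqP aE _]].
have [|x xE] := @in_ground_onto [predC A] (enum (B :\: Some @: A)).
  move=> t; rewrite mem_enum inE => /andP[tA _]; apply: contra tA => tA.
  by apply/imsetP; exists t.
exists x; rewrite -xE gp_enum //.
  by rewrite aE -setI_eq0 setDE -setIA [~: _ :&: _]setIA [~: _ :&: _]setIC setICr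
    set0I setI0.
by rewrite aE setIC setUC setID.
Qed.

Lemma pull_pmatP (P : pred T) (a : seq (option T))
  (H : exists x, mu (map (@in_ground T P) x ++ a) != zerob) :
  forall x, None \in x -> gp (gp_matroid (gp_pull (gpP (pmat M)) H)) x = zerob.
Proof.
move=> x xN; have [b _ ->] := gp_matroidE (gp_pull (gpP (pmat M)) H).
by rewrite pmatP ?mulb0 // mem_cat (map_f (@in_ground T P) xN).
Qed.

(* M|A and M/A: the classes of x |-> mu (x, c) and x |-> mu (x, a), where c and
   a are ordered bases of the underlying matroids of M/A and M|A. *)
Definition restr (A : {set T}) : pmatroid F := PMatroid (pull_pmatP (restr_subproof A)).

Definition contr (A : {set T}) : pmatroid F := PMatroid (pull_pmatP (contr_subproof A)).

End RestrictionContraction.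

Section Matrices.
Variable F : idyllType.
Implicit Types (I J K L : finType).

Definition submonomial I J (f : I -> J -> F) : Prop :=
  (forall i j j', f i j != zerob -> f i j' != zerob -> j = j') /\
  (forall j i i', f i j != zerob -> f i' j != zerob -> i = i').

(* The element of F equal in F^+ to a formal sum with at most one nonzero term,
   such as the entries of products with submonomial matrices; see [mulmv_sum]. *)
Definition fsum_val (s : seq F) : F := head zerob [seq a <- s | a != zerob].

Definition mulmv I J (f : I -> J -> F) (X : J -> F) (i : I) : F :=
  fsum_val [seq f i j * X j | j <- enum J].

Definition mulmm I J K (g : I -> J -> F) (f : J -> K -> F) (i : I) (k : K) : F :=
  fsum_val [seq g i j * f j k | j <- enum J].

(* The matrix (delta_ij), for index sets contained in a common set T. *)
Definition delta_mx (T : eqType) I J (u : I -> T) (v : J -> T) (i : I) (j : J) : F :=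
  if u i == v j then 1 else zerob.

Lemma filter_sum1 J (G : J -> F) j0 : (forall j, G j != zerob -> j = j0) ->
  [seq a <- [seq G j | j <- enum J] | a != zerob] =
  [seq a <- [:: G j0] | a != zerob].
Proof.
move=> G0; rewrite filter_map /=.
have [Gj0|Gj0] /= := eqVneq (G j0) zerob.
  rewrite (@eq_filter _ _ pred0) ?filter_pred0 // => j /=.
  by apply/negbTE/negP => Gj; move: (Gj); rewrite (G0 j Gj) Gj0 eqxx.
rewrite (@eq_filter _ _ (pred1 j0)) ?filter_pred1_uniq ?enum_uniq ?mem_enum //=.
by move=> j /=; apply/idP/eqP => [Gj|->] //; apply: G0.
Qed.

Lemma fsum_val0 J (G : J -> F) : (forall j, G j = zerob) ->
  fsum_val [seq G j | j <- enum J] = zerob.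
Proof.
move=> G0; rewrite /fsum_val filter_map (@eq_filter _ _ pred0) ?filter_pred0 //.
by move=> j /=; rewrite G0 eqxx.
Qed.

Lemma fsum_val1 J (G : J -> F) j0 : (forall j, G j != zerob -> j = j0) ->
  fsum_val [seq G j | j <- enum J] = G j0.
Proof. by move=> /filter_sum1; rewrite /fsum_val => -> /=; case: eqP. Qed.

Lemma mulmv_sum I J (f : I -> J -> F) X i : submonomial f ->
  fsum_eq [seq f i j * X j | j <- enum J] [:: mulmv f X i].
Proof.
move=> [fr _].
have [[j fij]|f0] := pselect (exists j, f i j != zerob).
  have fX k : f i k * X k != zerob -> k = j.
    by rewrite mulb_eq0 negb_or => /andP[fik _]; apply: fr fij.
  by rewrite /fsum_eq (filter_sum1 fX) /mulmv (fsum_val1 fX).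
have {}f0 j : f i j * X j = zerob.
  apply/eqP; rewrite mulb_eq0; apply/orP; left; apply/negPn/negP => fij.
  by apply: f0; exists j.
rewrite /fsum_eq /mulmv fsum_val0 //= eqxx filter_map.
by rewrite (@eq_filter _ _ pred0) ?filter_pred0 // => j /=; rewrite f0 eqxx.
Qed.

Lemma mulmvE I J (f : I -> J -> F) X i j :
  submonomial f -> f i j != zerob -> mulmv f X i = f i j * X j.
Proof.
move=> [fr _] fij; rewrite /mulmv (@fsum_val1 _ _ j) // => k.
by rewrite mulb_eq0 negb_or => /andP[fik _]; apply: fr fij.
Qed.

Lemma mulmv0 I J (f : I -> J -> F) X i :
  (forall j, f i j = zerob) -> mulmv f X i = zerob.
Proof. by move=> f0; apply: fsum_val0 => j; rewrite f0 mul0b. Qed.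

Lemma row_cases I J (f : I -> J -> F) i :
  (exists j, f i j != zerob) \/ (forall j, f i j = zerob).
Proof.
have [|f0] := pselect (exists j, f i j != zerob); [by left | right => j].
by apply/eqP/negPn/negP => fij; apply: f0; exists j.
Qed.

Lemma mulmm_neq0 I J K (g : I -> J -> F) (f : J -> K -> F) i k :
  submonomial g -> mulmm g f i k != zerob ->
  exists2 j, g i j != zerob & f j k != zerob.
Proof.
move=> gs; rewrite -[mulmm g f i k]/(mulmv g (f^~ k) i).
have [[j gij]|g0] := row_cases g i; last by rewrite mulmv0 ?eqxx.
by rewrite (mulmvE _ gs gij) mulb_eq0 negb_or => /andP[]; exists j.
Qed.

Lemma mulmm_submonomial I J K (g : I -> J -> F) (f : J -> K -> F) :
  submonomial g -> submonomial f -> submonomial (mulmm g f).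
Proof.
move=> gs fs; split=> [i k k'|k i i'].
  move=> /(mulmm_neq0 gs)[j gij fjk] /(mulmm_neq0 gs)[j' gij' fjk'].
  by rewrite -(gs.1 _ _ _ gij gij') in fjk'; apply: fs.1 fjk fjk'.
move=> /(mulmm_neq0 gs)[j gij fjk] /(mulmm_neq0 gs)[j' gij' fjk'].
by rewrite -(fs.2 _ _ _ fjk fjk') in gij'; apply: gs.2 gij gij'.
Qed.

Lemma mulmvA I J K (h : I -> J -> F) (g : J -> K -> F) (X : K -> F) :
  submonomial h -> submonomial g -> mulmv h (mulmv g X) = mulmv (mulmm h g) X.
Proof.
move=> hs gs; apply/funext => i; have hgs := mulmm_submonomial hs gs.
have [[j hij]|h0] := row_cases h i; last first.
  rewrite mulmv0 // mulmv0 // => k.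
  by rewrite -[mulmm h g i k]/(mulmv h (g^~ k) i) mulmv0.
have hgE k : mulmm h g i k = h i j * g j k by apply: (mulmvE (g^~ k) hs hij).
rewrite (mulmvE _ hs hij).
have [[k gjk]|g0] := row_cases g j; last first.
  by rewrite [mulmv g X j]mulmv0 // mulb0 mulmv0 // => k; rewrite hgE g0 mulb0.
rewrite (mulmvE _ gs gjk) (@mulmvE _ _ (mulmm h g) _ _ k) // hgE ?mulgA //.
by rewrite mulb_neq0.
Qed.

Lemma mulmmA I J K L (h : I -> J -> F) (g : J -> K -> F) (f : K -> L -> F) :
  submonomial h -> submonomial g -> mulmm h (mulmm g f) = mulmm (mulmm h g) f.
Proof.
move=> hs gs; apply/funext => i; apply/funext => l.
exact: (congr1 (fun X => X i) (mulmvA (f^~ l) hs gs)).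
Qed.

Definition id_mx I : I -> I -> F := delta_mx id id.

Lemma id_mx_neq0 I (i j : I) : @id_mx I i j != zerob -> i = j.
Proof. by rewrite /id_mx /delta_mx /=; case: (i =P j) => //; rewrite eqxx. Qed.

Lemma id_mx_submonomial I : submonomial (@id_mx I).
Proof.
by split=> [i j j' /id_mx_neq0 <- /id_mx_neq0|j i i' /id_mx_neq0 -> /id_mx_neq0].
Qed.

Lemma mul1mv I (X : I -> F) : mulmv (@id_mx I) X = X.
Proof.
apply/funext => i; have ii : @id_mx I i i = 1 by rewrite /id_mx /delta_mx /= eqxx.
rewrite (@mulmvE _ _ _ _ _ i) ?ii ?mul1g //; first exact: id_mx_submonomial.
exact: oneb_neq0.
Qed.

Lemma mul1mm I J (f : I -> J -> F) : mulmm (@id_mx I) f = f.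
Proof.
apply/funext => i; apply/funext => j.
exact: (congr1 (fun X => X i) (mul1mv (f^~ j))).
Qed.

End Matrices.

Arguments id_mx F I : clear implicits.

Section Category.
Variable F : idyllType.
Implicit Types L M N : pmatroid F.

Record hom M N := Hom {
  hom_mx :> pground N -> pground M -> F;
  hom_submonomial : submonomial hom_mx;
  hom_vectors : forall X, pvectors M X -> pvectors N (mulmv hom_mx X)
}.

Lemma hom_eq M N (f g : hom M N) : hom_mx f = hom_mx g -> f = g.
Proof.
case: f g => f fs fv [g gs gv] /= fg; rewrite -{}fg in gs gv *.
by rewrite (Prop_irrelevance fs gs) (Prop_irrelevance fv gv).
Qed.

Lemma id_hom_subproof M X : pvectors M X -> pvectors M (mulmv (id_mx F _) X).
Proof. by rewrite mul1mv. Qed.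

Definition id_hom M : hom M M :=
  Hom (@id_mx_submonomial F (pground M)) (@id_hom_subproof M).

Lemma comp_hom_subproof L M N (g : hom M N) (f : hom L M) X :
  pvectors L X -> pvectors N (mulmv (mulmm g f) X).
Proof.
move=> XL; rewrite -mulmvA; [|exact: hom_submonomial..].
exact/hom_vectors/hom_vectors.
Qed.

Definition comp_hom L M N (g : hom M N) (f : hom L M) : hom L N :=
  Hom (mulmm_submonomial (hom_submonomial g) (hom_submonomial f))
      (@comp_hom_subproof L M N g f).

Definition is_iso M N (f : hom M N) : Prop :=
  exists g : hom N M, comp_hom g f = id_hom M /\ comp_hom f g = id_hom N.

Definition isomorphic M N : Prop := exists f : hom M N, is_iso f.

Lemma comp_homA K L M N (h : hom M N) (g : hom L M) (f : hom K L) :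
  comp_hom h (comp_hom g f) = comp_hom (comp_hom h g) f.
Proof. by apply: hom_eq; rewrite /= mulmmA //; exact: hom_submonomial. Qed.

Lemma comp1hom M N (f : hom M N) : comp_hom (id_hom N) f = f.
Proof. by apply: hom_eq; rewrite /= mul1mm. Qed.

Lemma isomorphic_refl M : isomorphic M M.
Proof. by exists (id_hom M), (id_hom M); rewrite comp1hom. Qed.

Lemma isomorphic_sym M N : isomorphic M N -> isomorphic N M.
Proof. by case=> f [g [gf fg]]; exists g, f. Qed.

Lemma isomorphic_trans L M N :
  isomorphic L M -> isomorphic M N -> isomorphic L N.
Proof.
move=> [f [f' [f'f ff']]] [g [g' [g'g gg']]].
exists (comp_hom g f), (comp_hom f' g'); split.
  by rewrite -comp_homA [comp_hom g' _]comp_homA g'g comp1hom.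
by rewrite -comp_homA [comp_hom f _]comp_homA ff' comp1hom.
Qed.

Definition restr_mx M (A : {set pground M}) :
  pground M -> pground (restr A) -> F := delta_mx F id val.

Definition contr_mx M (A : {set pground M}) :
  pground (contr A) -> pground M -> F := delta_mx F val id.

(* U >-> X ->> V is isomorphic to M|A >-> M ->> M/A for some M and A. *)
Definition short_exact U X V (i : hom U X) (p : hom X V) : Prop :=
  exists (M : pmatroid F) (A : {set pground M})
         (u : hom U (restr A)) (x : hom X M) (v : hom V (contr A)),
    [/\ is_iso u, is_iso x, is_iso v,
        mulmm x i = mulmm (@restr_mx M A) u & mulmm v p = mulmm (@contr_mx M A) x].

End Category.

Section Renaming.
Variables (F : idyllType) (E E' : finType) (phi : E' -> E) (psi : E -> E').
Hypotheses (phiK : cancel phi psi) (psiK : cancel psi phi).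
Hypothesis phi_enum : map phi (enum E') = enum E.
Implicit Types (mu : seq E -> F).

Let phi_inj := can_inj phiK.

Lemma odd_perm_rename (s : {perm E}) (s' : {perm E'}) :
  (forall i, phi (s' i) = s (phi i)) -> odd_perm s' = odd_perm s.
Proof.
move=> sE; have sXE k i : phi ((s' ^+ k) i) = (s ^+ k) (phi i).
  by elim: k i => [|k IHk] i; rewrite ?expg0 ?perm1 // !expgSr !permM sE IHk.
have orbE i : porbit s (phi i) = phi @: porbit s' i.
  apply/setP => e; apply/porbitP/imsetP => [[k ->]|[_ /porbitP[k ->] ->]].
    by exists ((s' ^+ k) i); rewrite ?sXE // mem_porbit.
  by exists k; rewrite sXE.
rewrite /odd_perm (_ : #|E'| = #|E|); last exact: (bij_eq_card (Bijective phiK psiK)).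
congr (_ (+) odd _); rewrite -(card_imset _ (imset_inj phi_inj)); apply: eq_card => B.
apply/imsetP/imsetP => [[_ /imsetP[i _ ->] ->]|[e _ ->]].
  by exists (phi i); rewrite ?orbE.
by exists (porbit s' (psi e)); [exact: imset_f | rewrite -orbE psiK].
Qed.

Lemma enum_rank_rename i : enum_rank (phi i) = enum_rank i :> nat.
Proof.
apply/eqP; rewrite -(nth_uniq (phi i) _ _ (enum_uniq E)); last 2 first.
- by rewrite -cardE.
- by rewrite -phi_enum size_map -cardE.
rewrite nth_enum_rank -phi_enum (nth_map i) ?nth_enum_rank //.
by rewrite -cardE.
Qed.

Lemma word_perm_rename x i : phi (word_perm x i) = word_perm (map phi x) (phi i).
Proof.
have wE j : phi ([ffun e => nth e x (enum_rank e)] j) =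
            [ffun e => nth e (map phi x) (enum_rank e)] (phi j).
  rewrite !ffunE enum_rank_rename; have [jx|xj] := ltnP (enum_rank j) (size x).
    by rewrite (nth_map j).
  by rewrite !nth_default ?size_map.
rewrite /word_perm /insubd; move: [ffun _ => _] [ffun _ => _] wE => w' w wE.
have valE (T : finType) (s : {perm T}) v : val s = v -> v =1 s.
  by move=> <- t; rewrite -pvalE.
case: insubP => [s' _ /valE s'E|w'N] /=; case: insubP => [s ws /valE sE|wN] /=.
- by rewrite -s'E -sE wE.
- case/negP: wN; apply/injectiveP => e1 e2; rewrite -[e1]psiK -[e2]psiK -!wE.
  by move=> /phi_inj; rewrite !s'E => /perm_inj ->.
- case/negP: w'N; apply/injectiveP => i1 i2 /(congr1 phi); rewrite !wE !sE.
  by move=> /perm_inj /phi_inj.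
- by rewrite !perm1.
Qed.

Lemma compl_word_rename x : compl_word (map phi x) = map phi (compl_word x).
Proof.
rewrite /compl_word -phi_enum filter_map; congr map; apply: eq_filter => i /=.
by rewrite (mem_map phi_inj).
Qed.

Lemma dual_rename mu x : dual (fun x => mu (map phi x)) x = dual mu (map phi x).
Proof.
rewrite /dual (map_inj_uniq phi_inj) compl_word_rename -map_cat.
by rewrite -(odd_perm_rename (word_perm_rename (x ++ compl_word x))).
Qed.

Lemma del_map (T T' : Type) (f : T -> T') k (x : seq T) :
  del k (map f x) = map f (del k x).
Proof. by rewrite /del map_cat map_take map_drop. Qed.

Lemma circuit_rename r mu X :
  circuit r mu X <-> circuit r (fun x => mu (map phi x)) (X \o phi).
Proof.
split=> -[a [y [a0 yU [k yk] Xy X0]]].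
  have yE : map phi (map psi y) = y by rewrite -map_comp map_id_in // => e; rewrite /= psiK.
  exists a, (map_tuple psi y); split=> //=.
  - by rewrite (map_inj_uniq (can_inj psiK)).
  - by exists k; rewrite -del_map yE.
  - by move=> j; rewrite -del_map yE -Xy tnth_map psiK.
  - move=> e ey; apply: X0; apply: contra ey => /(map_f psi).
    by rewrite phiK.
exists a, (map_tuple phi y); split=> //=.
- by rewrite (map_inj_uniq phi_inj).
- by exists k; rewrite del_map.
- by move=> j; rewrite del_map -Xy tnth_map.
- move=> e ey; rewrite -[e]psiK; apply: X0; apply: contra ey.
  by move=> /(map_f phi); rewrite psiK.
Qed.

Lemma perp_rename (X Y : E -> F) : perp X Y <-> perp (X \o phi) (Y \o phi).
Proof. by rewrite /perp -phi_enum -map_comp. Qed.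

Lemma vectors_rename mu r (X : E -> F) :
  orth (circuit r (dual mu)) X <->
  orth (circuit r (dual (fun x => mu (map phi x)))) (X \o phi).
Proof.
rewrite (_ : dual (fun x => mu (map phi x)) = fun x => dual mu (map phi x)); last first.
  by apply/funext => x; rewrite dual_rename.
split=> HX Y.
  rewrite (_ : Y = (Y \o psi) \o phi); last by apply/funext => i /=; rewrite phiK.
  by move=> /circuit_rename /HX /perp_rename.
by move=> /circuit_rename /HX /perp_rename.
Qed.

End Renaming.

Lemma dual_scale (F : idyllType) (E : finType) (a : F) (mu : seq E -> F) :
  dual (fun x => a * mu x) = (fun x => a * dual mu x).
Proof.
apply/funext => x; rewrite /dual; case: ifP; last by rewrite mulb0.
by rewrite !mulgA [a * _]mulbC.
Qed.

Lemma circuit_scale (F : idyllType) (E : finType) r (a : F) (mu : seq E -> F) X :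
  a != zerob -> circuit r mu X <-> circuit r (fun x => a * mu x) X.
Proof.
move=> a0; have [b ab] := idyll_unit a a0.
have b0 : b != zerob.
  by apply: contraTneq (@oneb_neq0 F) => b0; rewrite -ab b0 mulb0 eqxx.
split=> -[c [y [c0 yU [k yk] Xy X0]]].
  exists (c * b), y; split=> //; rewrite ?mulb_neq0 //.
    by exists k; rewrite mulb_neq0.
  move=> j; rewrite Xy -mulgA; congr (_ * _).
  by rewrite [sgn F j * (a * _)]mulgA [_ * a]mulbC !mulgA [b * a]mulbC ab mul1g.
exists (c * a), y; split=> //; rewrite ?mulb_neq0 //.
  by exists k; apply: contraNneq yk => ->; rewrite mulb0.
by move=> j; rewrite Xy -mulgA; congr (_ * _); rewrite !mulgA [a * _]mulbC.
Qed.

Lemma orth_dual_scale (F : idyllType) (E : finType) r (a : F) (mu : seq E -> F) X :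
  a != zerob -> orth (circuit r (dual (fun x => a * mu x))) X <->
                orth (circuit r (dual mu)) X.
Proof.
move=> a0; rewrite dual_scale; split=> HX Y YC; apply: HX.
  exact: (circuit_scale _ _ _ a0).1.
exact: (circuit_scale _ _ _ a0).2.
Qed.

Lemma vectors_gp_matroid (F : idyllType) (E : finType) r (mu : seq E -> F)
    (mu_gp : gp_function r mu) X :
  vectors (gp_matroid mu_gp) X <-> orth (circuit (#|E| - r) (dual mu)) X.
Proof.
have [a a0 muE] := gp_matroidE mu_gp.
by rewrite /vectors /cocircuits muE; apply: orth_dual_scale.
Qed.

Section RenamingIso.
Variables (F : idyllType) (M N : pmatroid F).
Variables (phi : pground N -> pground M) (psi : pground M -> pground N).
Hypotheses (phiK : cancel phi psi) (psiK : cancel psi phi).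
Hypothesis phi_enum : map phi (enum (pground N)) = enum (pground M).
Hypothesis frankE : frank (pmat N) = frank (pmat M).
Variable a : F.
Hypotheses (a_neq0 : a != zerob)
  (gpE : gp (pmat N) = fun x => a * gp (pmat M) (map (omap phi) x)).

Lemma pvectors_rename X : pvectors M X <-> pvectors N (X \o phi).
Proof.
have eqNM : #|pground N| = #|pground M| := bij_eq_card (Bijective phiK psiK).
rewrite /pvectors /del_point.
apply: iff_trans (vectors_gp_matroid _ _) _; apply: iff_sym.
apply: iff_trans (vectors_gp_matroid _ _) _; apply: iff_sym.
rewrite frankE eqNM; set m := fun x => gp (pmat M) _.
have -> : (fun x => gp (pmat N) (map Some x ++ [::])) =
          (fun x => a * (fun x => m (map phi x)) x).
  by apply/funext => x; rewrite gpE /m !cats0 -!map_comp.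
apply: iff_trans (iff_sym (orth_dual_scale _ _ _ a_neq0)).
exact: vectors_rename.
Qed.

Let f : pground N -> pground M -> F := delta_mx F phi id.
Let g : pground M -> pground N -> F := delta_mx F id phi.

Let fphi i : f i (phi i) = 1.
Proof. by rewrite /f /delta_mx eqxx. Qed.

Let gpsi e : g e (psi e) = 1.
Proof. by rewrite /g /delta_mx psiK eqxx. Qed.

Let f_sub : submonomial f.
Proof.
have fP i e : f i e != zerob -> phi i = e.
  by rewrite /f /delta_mx; case: (phi i =P e) => //; rewrite eqxx.
by split=> [i e e' /fP <- /fP //|e i i' /fP <- /fP /(can_inj phiK) ->].
Qed.

Let g_sub : submonomial g.
Proof.
have gE e i : g e i = f i e by rewrite /g /f /delta_mx eq_sym.
by split=> [e i i'|i e e']; rewrite !gE; [apply: f_sub.2 | apply: f_sub.1].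
Qed.

Let f_mul X : mulmv f X = X \o phi.
Proof.
apply/funext => i; rewrite (@mulmvE _ _ _ _ _ _ (phi i)) ?fphi ?mul1g //.
exact: oneb_neq0.
Qed.

Let g_mul X : mulmv g X = X \o psi.
Proof.
apply/funext => e; rewrite (@mulmvE _ _ _ _ _ _ (psi e)) ?gpsi ?mul1g //.
exact: oneb_neq0.
Qed.

Lemma isomorphic_rename : isomorphic M N.
Proof.
have fv X : pvectors M X -> pvectors N (mulmv f X).
  by rewrite f_mul => /pvectors_rename.
have gv X : pvectors N X -> pvectors M (mulmv g X).
  move=> XN; apply/pvectors_rename; rewrite g_mul.
  by rewrite (_ : (X \o psi) \o phi = X) //; apply/funext => i /=; rewrite phiK.
exists (Hom f_sub fv), (Hom g_sub gv).
split; apply: hom_eq; apply/funext => i; apply/funext => j /=.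
  rewrite -[LHS]/(mulmv g (f^~ j) i) g_mul /= /f /delta_mx psiK //.
rewrite -[LHS]/(mulmv f (g^~ j) i) f_mul /= /g /delta_mx /id_mx /delta_mx.
by rewrite (inj_eq (can_inj phiK)).
Qed.

End RenamingIso.

Section K0.
Variable F : idyllType.

(* [pmatroid F] quantifies over finType, hence lies in too large a universe for
   the carrier of a choiceType. The objects with ground set 'I_n \sqcup {*} form
   a small type, and the quotient of the latter by isomorphism is the set of
   isomorphism classes of all objects: see [class_ofP] and [class_of_onto]. *)
Record small_pmatroid := SmallPMatroid {
  sdim : nat;
  smat : fmatroid F (option 'I_sdim);
  smatP : forall x, None \in x -> gp smat x = zerob
}.

Definition pmatroid_of_small (M : small_pmatroid) : pmatroid F :=
  PMatroid (@smatP M).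

Lemma relabel_subproof (M : pmatroid F) :
  exists x, gp (pmat M)
    (map (omap (@enum_val _ [in pground M])) x ++ [::]) != zerob.
Proof.
have [x x0] := gp_neq0 (gpP (pmat M)).
exists (map (omap enum_rank) x); rewrite cats0 -map_comp.
rewrite (_ : map _ _ = x) //.
by apply: map_id_in => -[t|] //= _; rewrite enum_rankK.
Qed.

Lemma relabel_smatP (M : pmatroid F) x : None \in x ->
  gp (gp_matroid (gp_pull (gpP (pmat M)) (relabel_subproof M))) x = zerob.
Proof.
move=> xN.
have [b _ ->] := gp_matroidE (gp_pull (gpP (pmat M)) (relabel_subproof M)).
by rewrite pmatP ?mulb0 // mem_cat (map_f (omap _) xN).
Qed.

Definition relabel (M : pmatroid F) : small_pmatroid :=
  SmallPMatroid (@relabel_smatP M).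

Local Notation obj := {classic small_pmatroid}.

Definition isob (M N : obj) : bool :=
  `[< isomorphic (pmatroid_of_small M) (pmatroid_of_small N) >].

Lemma isob_refl : reflexive isob.
Proof. by move=> M; apply/asboolP/isomorphic_refl. Qed.

Lemma isob_sym : symmetric isob.
Proof.
by move=> M N; apply/asboolP/asboolP; apply: isomorphic_sym.
Qed.

Lemma isob_trans : transitive isob.
Proof.
by move=> M L N /asboolP LM /asboolP MN; apply/asboolP/(isomorphic_trans LM).
Qed.

Canonical isob_equiv := EquivRel isob isob_refl isob_sym isob_trans.

Definition isoclass := {eq_quot isob_equiv}%qT.
HB.instance Definition _ := Choice.on isoclass.

Definition class_of (M : pmatroid F) : isoclass :=
  (\pi_isoclass (relabel M : obj))%qT.

Lemma relabelP (M : pmatroid F) : isomorphic M (pmatroid_of_small (relabel M)).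
Proof.
have [a a0 gpE] := gp_matroidE (gp_pull (gpP (pmat M)) (relabel_subproof M)).
apply: (@isomorphic_rename _ M (pmatroid_of_small (relabel M))
          (@enum_val _ [in pground M]) enum_rank _ _ _ _ a a0).
- by move=> i; rewrite enum_valK.
- by move=> t; rewrite enum_rankK.
- have [t _|T0] := pickP (pground M); last first.
    rewrite [RHS](eq_enum T0) enum0; apply: size0nil.
    by rewrite size_map -cardE card_ord; apply: eq_card0 => t; apply: T0.
  rewrite (@map_enum_ord _ _ _ (nth t (enum (pground M)))); last first.
    by move=> k; apply: enum_val_nth.
  rewrite /= -[RHS](mkseq_nth t); congr (map _ (iota 0 _)).
  by rewrite cardE.
- by rewrite /= subn0.
- by rewrite gpE; apply/funext => x; rewrite cats0.
Qed.

Lemma class_ofP (M N : pmatroid F) : class_of M = class_of N <-> isomorphic M N.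
Proof.
split=> [/eqmodP/asboolP MN|MN].
  apply: isomorphic_trans (relabelP M) _; apply: isomorphic_trans MN _.
  exact/isomorphic_sym/relabelP.
apply/eqmodP/asboolP; apply: isomorphic_trans (isomorphic_sym (relabelP M)) _.
exact: isomorphic_trans MN (relabelP N).
Qed.

Lemma class_of_onto (c : isoclass) : exists M, class_of M = c.
Proof.
elim/quotW: c => M; exists (pmatroid_of_small M).
by apply/eqmodP/asboolP/isomorphic_sym/relabelP.
Qed.

Local Open Scope ring_scope.

Definition gen (M : pmatroid F) : {freeg isoclass} := << 1 *g class_of M >>.

(* The subgroup generated by the [X] - ([U] + [V]). *)
Definition k0_rel : {pred {freeg isoclass}} := fun z =>
  `[< forall S : {pred {freeg isoclass}}, zmod_closed S ->
        (forall U X V (i : hom U X) (p : hom X V),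
           short_exact i p -> gen X - (gen U + gen V) \in S) ->
        z \in S >].

Lemma k0_rel_closed : zmod_closed k0_rel.
Proof.
split=> [|x y /asboolP xS /asboolP yS]; apply/asboolP => S SC SP; first exact: SC.1.
by apply: SC.2; [apply: xS | apply: yS].
Qed.

HB.instance Definition _ := GRing.isZmodClosed.Build _ k0_rel k0_rel_closed.

Definition K0 := Quotient.quot k0_rel.
HB.instance Definition _ := GRing.Zmodule.on K0.

End K0.

(* Main.v *)
Require Import Defs.
From mathcomp Require Import all_boot all_algebra.
From HB Require Import structures.
From mathcomp Require Import all_fingroup boolp.
From mathcomp.multinomials Require Import freeg.
(* so that [hom] denotes the morphisms of pointed matroids *)
Import Defs.

(** Rank and corank (number of elements minus rank) identify K_0 with Z + Z.

    They define a homomorphism on K_0. They are invariant under isomorphism: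
    an isomorphism matches the ground sets and the sets of vectors, and the rank
    can be read off from the vectors, since a basis supports no nonzero vector
    while every set with more elements than the rank supports a circuit
    ([gp_vector_basis], [gp_vector_dependent], [isomorphic_frank_le]). They are
    additive on short exact sequences because the ranks of M|A and M/A add up to
    that of M ([frank_restr], [frank_contr]).

    Conversely, K_0 is generated by the classes of the two matroids on one
    element, the loop and the coloop, whose (rank, corank) are (0, 1) and (1, 0).
    For an element e of M, the sequence M|e >-> M ->> M/e gives
    [M] = [M|e] + [M/e], where M|e is a loop or a coloop; induction on the number
    of elements expresses [M] by its rank and corank
    ([k0_of_pair_rank_corank]).

    This needs the matrices of M|A >-> M and M ->> M/A to be morphisms, that is,
    to preserve vectors. All such arguments use a description of vectors free of
    signs and of any ordering of the ground set: the cocircuits are the functions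
    b * mu (_, y), so X is a vector exactly if the sum of the X_e * mu (e, y) is
    null for all y ([orth_dualP]). Contraction then preserves vectors because
    mu (e, y, a) vanishes for e in A when a is a basis of M|A. For restriction,
    the Grassmann-Pluecker relations say that the cocircuits of M restrict to
    covectors of M|A, and perfection concludes ([restr_pvectors]). *)

Set Implicit Arguments.
Unset Strict Implicit.
Unset Printing Implicit Defensive.

Import GRing.Theory.

Local Open Scope group_scope.

(** * Signs and null sums *)

Section NullSums.
Variable F : idyllType.
Implicit Types (a b c : F) (s t : seq F).

Lemma mulbCA a b c : a * (b * c) = b * (a * c).
Proof. by rewrite !mulgA [a * b]mulbC. Qed.

Lemma null_scale a s : null s -> null [seq a * x | x <- s].
Proof. by move=> /(nullM [:: a]); rewrite /= cats0. Qed.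

Lemma null_seq0 s : all (pred1 zerob) s -> null s.
Proof.
move=> s0; apply: null_eq (@null0 F); rewrite /fsum_eq /= perm_sym.
suff -> : [seq a <- s | a != zerob] = [::] by [].
by elim: s s0 => //= a s IHs /andP[/eqP-> /IHs]; rewrite eqxx.
Qed.

Lemma oppb0 : oppb zerob = zerob :> F.
Proof. by apply/esym/oppbP/null_seq0; rewrite /= eqxx. Qed.

Lemma null1 a : null [:: a] -> a = zerob.
Proof.
move=> a0; rewrite -oppb0; apply/oppbP.
by apply: null_eq a0; rewrite /fsum_eq /= eqxx.
Qed.

Lemma null_rev2 a b : null [:: a; b] -> null [:: b; a].
Proof.
apply: null_eq; rewrite /fsum_eq; apply: perm_filter.
by rewrite (perm_catC [:: a] [:: b]).
Qed.

Lemma oppbM a : oppb a = oppb 1 * a.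
Proof.
apply/esym/oppbP; have /(null_scale a) : null [:: 1; oppb 1 : F] by apply/oppbP.
by rewrite /= mulg1 [a * _]mulbC.
Qed.

Lemma oppb1K : oppb 1 * oppb 1 = 1 :> F.
Proof. by rewrite -oppbM; apply/esym/oppbP/null_rev2/oppbP. Qed.

Lemma sgnS n : sgn F n.+1 = oppb 1 * sgn F n.
Proof. by rewrite /sgn expgS. Qed.

Lemma sgnD m n : sgn F (m + n) = sgn F m * sgn F n.
Proof. by elim: m => [|m IHm]; rewrite ?addSn ?sgnS ?IHm ?mulgA // mul1g. Qed.

Lemma sgnK n : sgn F n * sgn F n = 1.
Proof.
elim: n => [|n IHn]; first by rewrite mul1g.
by rewrite sgnS -mulgA [sgn F n * _]mulbCA IHn mulg1 oppb1K.
Qed.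

(** Null sums over a finite index type only see the indices with a nonzero
    term, hence may be transported along any injection hitting all of these. *)
Lemma null_reindex (I J : finType) (h : I -> J) (G : J -> F) :
  injective h -> (forall j, G j != zerob -> exists i, j = h i) ->
  null [seq G (h i) | i <- enum I] <-> null [seq G j | j <- enum J].
Proof.
move=> h_inj hG; suff eqG : fsum_eq [seq G (h i) | i <- enum I] [seq G j | j <- enum J].
  by split; apply: null_eq; rewrite // /fsum_eq perm_sym.
rewrite /fsum_eq (map_comp G h) !(filter_map G); apply: perm_map; apply: uniq_perm.
- by rewrite filter_uniq // map_inj_uniq // enum_uniq.
- by rewrite filter_uniq // enum_uniq.
move=> j; rewrite [LHS]mem_filter [RHS]mem_filter mem_enum andbT /=.
have [//|/hG[i ->]] := eqVneq (G j) zerob; apply/mapP; exists i; rewrite ?mem_enum //.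
Qed.

End NullSums.

(** * Alternating functions on words, and the cocircuits *)

Section Alternation.
Variables (F : idyllType) (E : finType).
Implicit Types (h mu : seq E -> F) (u v w x y z : seq E).

Definition swap_alternating h := forall u a b v,
  h (u ++ b :: a :: v) = oppb 1 * h (u ++ a :: b :: v).

Lemma gp_swap r mu : gp_function r mu -> swap_alternating mu.
Proof.
move=> muP u a b v; set w := u ++ a :: b :: v; set w' := u ++ _.
have sz : size w' = size w by rewrite !size_cat.
have [wr|wr] := eqVneq (size w) r; last first.
  have mu0 x : size x = size w -> mu x = zerob.
    by move=> xw; apply: contra_neq_eq wr => /(gp_size muP) <-.
  by rewrite !mu0 // mulb0.
have ir : size u < r by rewrite -wr size_cat /= !addnS ltnS leqW ?leq_addr.
have jr : (size u).+1 < r by rewrite -wr size_cat /= !addnS !ltnS leq_addr.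
have wr' : size w == r by apply/eqP.
have /= := gp_perm muP (Tuple wr') (tperm (Ordinal ir) (Ordinal jr)).
rewrite odd_tperm -val_eqE /= neq_ltn ltnSn /= /sgn expg1 => <-; congr mu.
apply: (@eq_from_nth _ a); first by rewrite size_map size_enum_ord sz.
move=> k; rewrite sz wr => kr.
rewrite (nth_map (Ordinal kr)) ?size_enum_ord // (nth_ord_enum _ (Ordinal kr)).
rewrite (tnth_nth a) /= /w' /w !nth_cat.
case: tpermP => [[->]|[->]|]; rewrite ?ltnn ?subnn /=.
- by rewrite ltnNge leqnSn subSnn.
- by rewrite ltnNge leqnSn subSnn.
move=> /eqP ki /eqP kj; have [//|uk] := ltnP k (size u).
rewrite -!val_eqE /= in ki kj.
by case: (k - size u)%N (subnK uk) ki kj => [|[|m]] // <-; rewrite ?add0n ?add1n eqxx.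
Qed.

Lemma swap_move h u a y v : swap_alternating h ->
  h (u ++ a :: y ++ v) = sgn F (size y) * h (u ++ y ++ a :: v).
Proof.
move=> hS; elim: y u => [|b y IHy] u; first by rewrite mul1g.
by rewrite /= hS sgnS -!(cat_rcons b) IHy mulgA.
Qed.

(** The exchanges of adjacent letters generate all rearrangements of a word. *)
Lemma swap_invariant (T : Type) (G : seq E -> T) :
  (forall u a b v, G (u ++ b :: a :: v) = G (u ++ a :: b :: v)) ->
  forall x y, perm_eq x y -> G x = G y.
Proof.
move=> GS; have GM u a y v : G (u ++ a :: y ++ v) = G (u ++ y ++ a :: v).
  by elim: y u => //= b y IHy u; rewrite GS -!(cat_rcons b) IHy.
suff GP u x y : perm_eq x y -> G (u ++ x) = G (u ++ y) by move=> x y /(GP [::]).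
elim: x u y => [|a x IHx] u y; first by rewrite perm_sym => /perm_nilP ->.
move=> xy; have ay : a \in y by rewrite -(perm_mem xy) mem_head.
case/splitPr: ay xy => p q.
rewrite perm_sym -[a :: q]cat1s perm_catCA perm_cons perm_sym => /IHx xpq.
by rewrite -cat_rcons xpq cat_rcons GM.
Qed.

(** The value zero off the enumerations of [E] makes the exchange rule
    [word_sgn_swap] hold for all words. *)
Definition word_sgn w : F :=
  if uniq w && (size w == #|E|) then sgn F (word_perm w) else zerob.

Lemma word_permE w e : uniq w -> size w = #|E| ->
  word_perm w e = nth e w (enum_rank e).
Proof.
move=> wU wE; rewrite -pvalE /word_perm insubdK ?ffunE //.
apply/injectiveP => i j; rewrite !ffunE => /eqP.
by rewrite (set_nth_default i j) ?nth_uniq ?wE // => /eqP /val_inj /enum_rank_inj.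
Qed.

(** In a word without repetition, exchanging two letters amounts to applying a
    transposition to every letter, which composes [word_perm] with it. *)
Lemma word_sgn_swap : swap_alternating word_sgn.
Proof.
move=> u a b v; set w := u ++ a :: b :: v; set w' := u ++ _.
have ww' : perm_eq w' w by rewrite perm_cat2l (perm_catCA [:: b] [:: a]).
rewrite /word_sgn (perm_uniq ww') (perm_size ww').
case: ifP => [/andP[wU /eqP wE]|]; last by rewrite mulb0.
have := wU; rewrite /w cat_uniq => /and3P[_ /hasPn uN /and3P[]].
rewrite inE negb_or => /andP[ab av] bv _.
have [au bu] : a \notin u /\ b \notin u by split; apply: uN; rewrite !inE eqxx ?orbT.
have tE s : a \notin s -> b \notin s -> map (tperm a b) s = s.
  move=> sa sb; rewrite map_id_in // => e es; rewrite tpermD //.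
    by apply: contraNneq sa => ->.
  by apply: contraNneq sb => ->.
have w'E : w' = map (tperm a b) w.
  by rewrite /w map_cat /= tpermL tpermR !tE.
have -> : word_perm w' = word_perm w * tperm a b.
  apply/permP => e; rewrite permM !word_permE ?(perm_uniq ww') ?(perm_size ww') //.
  by rewrite w'E (nth_map e) // wE.
by rewrite odd_permM odd_tperm ab addbT; case: odd_perm; rewrite ?oppb1K // mulg1.
Qed.

Lemma perm_del (e : E) k x : k < size x -> perm_eq x (nth e x k :: del k x).
Proof.
move=> kx; rewrite -{1}(cat_take_drop k x) (drop_nth e) //.
by rewrite (perm_catCA _ [:: _]).
Qed.

Lemma mem_compl_word x e : (e \in compl_word x) = (e \notin x).
Proof. by rewrite mem_filter mem_enum andbT. Qed.

Lemma compl_word_uniq x : uniq (compl_word x).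
Proof. by rewrite filter_uniq // enum_uniq. Qed.

Lemma uniq_cat_compl x : uniq x -> uniq (x ++ compl_word x).
Proof.
move=> xU; rewrite cat_uniq xU compl_word_uniq andbT.
by apply/hasPn => e; rewrite mem_compl_word.
Qed.

Lemma size_cat_uniq_compl x y : uniq x -> perm_eq y (compl_word x) ->
  size (x ++ y) = #|E|.
Proof.
move=> xU xy; rewrite cardE size_cat (perm_size xy) -size_cat.
apply/perm_size/uniq_perm; rewrite ?uniq_cat_compl ?enum_uniq // => e.
by rewrite mem_cat mem_compl_word mem_enum orbN.
Qed.

(** The two signs produced by a swap in the complementary word cancel, so that
    [dual mu x] may be computed from any enumeration of the complement of [x]. *)
Lemma dualE r mu x y : gp_function r mu -> uniq x -> perm_eq y (compl_word x) ->
  dual mu x = word_sgn (x ++ y) * mu y.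
Proof.
move=> muP xU xy.
rewrite (swap_invariant (G := fun y => word_sgn (x ++ y) * mu y) _ xy).
  by rewrite /dual xU /word_sgn uniq_cat_compl // size_cat_uniq_compl //= eqxx.
move=> u a b v; rewrite (gp_swap muP) !catA word_sgn_swap -!catA.
by rewrite mulbCA !mulgA oppb1K mul1g.
Qed.

(** Moving the letter x_k from its place in x to the end of x costs the sign
    (-1)^(n-k), where n+1 is the length of x. Together with the sign (-1)^k of
    the circuits, this is independent of k. *)
Lemma dual_del r mu e k n x y : gp_function r mu -> uniq x ->
    perm_eq y (compl_word x) -> size x = n.+1 -> k <= n ->
  sgn F k * dual mu (del k x) =
  sgn F n * word_sgn (x ++ y) * mu (nth e x k :: y).
Proof.
move=> muP xU xy xn kn; have kx : k < size x by rewrite xn.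
have xk := perm_del e kx; have := xU; rewrite (perm_uniq xk) /= => /andP[ekx dU].
rewrite (dualE (y := nth e x k :: y) muP) //; last first.
  apply: uniq_perm; rewrite ?compl_word_uniq //=.
    rewrite (perm_mem xy) mem_compl_word (perm_uniq xy) compl_word_uniq.
    by rewrite (perm_mem xk) mem_head.
  move=> i; rewrite inE (perm_mem xy) !mem_compl_word (perm_mem xk).
  by rewrite inE negb_or; case: eqP => [->|].
have -> : word_sgn (x ++ y) = sgn F (n - k) * word_sgn (del k x ++ nth e x k :: y).
  rewrite -{1}(cat_take_drop k x) (drop_nth e) // -catA cat_cons.
  rewrite (swap_move _ _ _ _ word_sgn_swap) size_drop xn subSS.
  by rewrite /del !catA.
have -> : sgn F n = sgn F k * sgn F (n - k) by rewrite -sgnD subnKC.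
by rewrite !mulgA -[_ * sgn F (n - k) * sgn F (n - k)]mulgA sgnK mulg1.
Qed.

(** A word x carrying a circuit of the dual and the complementary word y determine
    each other up to order. By [dual_del], the entries of the circuit are those of
    mu (_, y) up to a factor independent of the entry, and outside of x, that is on
    y, both vanish. *)
Lemma dual_circuitP r mu Y : gp_function r mu ->
  circuit (#|E| - r) (dual mu) Y <->
  exists b y, [/\ b != zerob, (size y).+1 = r, exists e, mu (e :: y) != zerob
                & Y = fun e => b * mu (e :: y)].
Proof.
move=> muP; have w0 x y : uniq x -> perm_eq y (compl_word x) ->
    word_sgn (x ++ y) != zerob.
  move=> xU xy; rewrite /word_sgn size_cat_uniq_compl // eqxx andbT.
  suff -> : uniq (x ++ y) by apply: sgn_neq0.
  rewrite -(perm_uniq (_ : perm_eq (x ++ compl_word x) _)) ?uniq_cat_compl //.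
  by rewrite perm_cat2l perm_sym.
have kle n (k : 'I_n.+1) : k <= n by rewrite -ltnS.
split=> [[a [x [a0 xU [k kx] Yx Y0]]]|[b [y [b0 yr [e ey] ->]]]].
  pose e := tnth x k; pose y := compl_word x.
  have delE := @dual_del _ _ e _ _ x y muP xU (perm_refl y) (size_tuple x) (kle _ _).
  have mu0 : mu (tnth x k :: y) != zerob.
    apply: contraNneq kx => mu0; rewrite (tnth_nth e) in mu0.
    have /eqP := delE k; rewrite mu0 mulb0 mulb_eq0 (negPf (sgn_neq0 _ _)) => /eqP.
    by move/eqP.
  exists (a * (sgn F (#|E| - r) * word_sgn (x ++ y))), y; split.
  - by rewrite !mulb_neq0 ?sgn_neq0 ?w0.
  - exact: (gp_size muP mu0).
  - by exists (tnth x k).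
  apply/funext => i; have [ix|ix] := boolP (i \in x).
    have /tnthP [j ->] := ix.
    by rewrite Yx delE -!mulgA -(tnth_nth e).
  by rewrite Y0 // (gp_rep muP) ?mulb0 //= mem_compl_word ix.
have : uniq (e :: y) by apply: contraNT ey => /(gp_rep muP) ->.
rewrite cons_uniq => /andP[eNy yU].
pose x := compl_word y; have xU : uniq x := compl_word_uniq y.
have yx : perm_eq y (compl_word x).
  apply: uniq_perm; rewrite ?compl_word_uniq // => i.
  by rewrite !mem_compl_word negbK.
have ex : e \in x by rewrite mem_compl_word.
have xn : size x = (#|E| - r).+1.
  have := size_cat_uniq_compl xU yx; rewrite size_cat -yr subnS => <-.
  by rewrite addnK prednK //; case: (x) ex.
have x_size : size x == (#|E| - r).+1 by apply/eqP.
pose c := sgn F (#|E| - r) * word_sgn (x ++ y).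
have c0 : c != zerob by rewrite mulb_neq0 ?sgn_neq0 ?w0.
have [c' cc'] := idyll_unit c c0.
have delE (k : 'I_(#|E| - r).+1) :
    sgn F k * dual mu (del k x) = c * mu (tnth (Tuple x_size) k :: y).
  by rewrite (tnth_nth e) (dual_del e muP xU yx xn).
exists (b * c'), (Tuple x_size); split=> //.
- apply: mulb_neq0 => //; apply/eqP => c'0.
  by have := @oneb_neq0 F; rewrite -cc' c'0 mulb0 eqxx.
- have /tnthP[k eE] : e \in Tuple x_size by [].
  exists k; apply: contraNneq ey => d0; have /eqP := delE k.
  by rewrite d0 mulb0 eq_sym mulb_eq0 (negPf c0) /= -eE.
- by move=> k; rewrite delE mulgA -[b * c' * c]mulgA [c' * c]mulbC cc' mulg1.
- move=> i; rewrite mem_compl_word negbK => iy.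
  by rewrite (gp_rep muP) ?mulb0 //= iy.
Qed.

(** This frees the vectors of a matroid from the sign of its dual and from the
    ordering of [E]. *)
Lemma orth_dualP r mu X : gp_function r mu ->
  orth (circuit (#|E| - r) (dual mu)) X <->
  forall y, (size y).+1 = r -> null [seq X e * mu (e :: y) | e <- enum E].
Proof.
move=> muP; split=> [XP y yr|XP Y /(dual_circuitP _ muP)[b [y [b0 yr _ ->]]]].
  have [[e ey]|/forallNP y0] := pselect (exists e, mu (e :: y) != zerob).
    apply: XP; apply/(dual_circuitP _ muP); exists 1, y.
    split=> //; [exact: oneb_neq0|by exists e|].
    by apply/funext => i; rewrite mul1g.
  apply: null_seq0; apply/allP => _ /mapP[e _ ->] /=.
  by have /negP := y0 e; rewrite negbK => /eqP ->; rewrite mulb0.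
have := null_scale b (XP y yr); rewrite -map_comp /perp.
by congr null; apply: eq_map => e /=; rewrite mulbCA.
Qed.

End Alternation.

(** * Vectors and the rank *)

Section Vectors.
Variables (F : idyllType) (E : finType).
Implicit Types (mu : seq E -> F) (X Y : E -> F) (x y : seq E).

(** By [orth_dualP], these are the vectors of the matroid of mu. *)
Definition gp_vector r mu X : Prop :=
  forall y, (size y).+1 = r -> null [seq X e * mu (e :: y) | e <- enum E].

(** Up to the factor of the circuit, this is the Grassmann-Pluecker relation. *)
Lemma circuit_gp_vector r mu X :
  gp_function r mu -> circuit r mu X -> gp_vector r mu X.
Proof.
move=> muP [a [x [a0 /tuple_uniqP x_inj _ Xx X0]]] y yr.
apply/(null_reindex x_inj) => [e|].
  have [/tnthP[k ->]|/X0 ->] := boolP (e \in x); first by exists k.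
  by rewrite mul0b eqxx.
have := null_scale a (gp_rel muP x yr); rewrite -map_comp.
by congr null; apply: eq_map => k /=; rewrite Xx -!mulgA.
Qed.

Lemma ex_circuit r mu (x : r.+1.-tuple E) (k : 'I_r.+1) :
  uniq x -> mu (del k x) != zerob ->
  exists X, circuit r mu X /\
    [/\ forall j : 'I_r.+1, X (tnth x j) = sgn F j * mu (del j x)
      & forall e, e \notin x -> X e = zerob].
Proof.
move=> xU xk; pose X e :=
  if e \in x then sgn F (index e x) * mu (del (index e x) x) else zerob.
have Xx (j : 'I_r.+1) : X (tnth x j) = sgn F j * mu (del j x).
  by rewrite /X mem_tnth (tnth_nth (tnth x k)) index_uniq ?size_tuple.
have X0 e : e \notin x -> X e = zerob by rewrite /X => /negPf ->.
exists X; split=> //; exists 1, x; split=> //; first exact: oneb_neq0.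
  by exists k.
by move=> j; rewrite Xx mul1g.
Qed.

(** For e in a basis x, the word x with e removed gives a relation whose only
    surviving term is that of e. *)
Lemma gp_vector_basis r mu x X :
  gp_function r mu -> mu x != zerob -> gp_vector r mu X ->
  (forall e, X e != zerob -> e \in x) -> forall e, X e = zerob.
Proof.
move=> muP x0 XV Xx e; apply/eqP/negPn/negP => Xe.
have xe := perm_to_rem (Xx e Xe); have xe0 := gp_permE muP xe x0.
have /null1/eqP : null [:: X e * mu (e :: rem e x)].
  apply: null_eq (XV _ (gp_size muP xe0)).
  rewrite /fsum_eq (@filter_sum1 F _ (fun i => X i * mu (i :: rem e x)) e) // => i.
  rewrite mulb_eq0 negb_or => /andP[/Xx + i0]; rewrite (perm_mem xe) inE.
  case/predU1P=> // ix; case/negP: i0; apply/eqP; apply: (gp_rep muP).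
  by rewrite /= ix.
by rewrite mulb_eq0 (negPf Xe) (negPf xe0).
Qed.

(** Choose a basis x meeting I in as many elements as possible and e in I
    outside of x. The fundamental circuit of e in x + e is supported in I: if
    it were nonzero at some b outside I, then x + e - b would be a basis meeting
    I in one more element than x. *)
Lemma gp_vector_dependent r mu (I : {set E}) :
  gp_function r mu -> r < #|I| ->
  exists X, [/\ gp_vector r mu X, exists e, X e != zerob
              & forall e, X e != zerob -> e \in I].
Proof.
move=> muP rI; have [x0 mux0] := gp_neq0 muP.
have x0r : size x0 == r by apply/eqP/(gp_size muP).
have := @arg_maxnP _ (Tuple x0r) (fun x : r.-tuple E => mu x != zerob)
  (fun x : r.-tuple E => #|[set:: x] :&: I|) mux0.
case=> x mux xmax.
have [e eI ex] : exists2 e, e \in I & e \notin [set:: x].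
  apply/subsetPn; apply: contraL rI => /subset_leq_card; rewrite -leqNgt => /leq_trans.
  by apply; rewrite cardsE -[X in _ <= X](size_tuple x) card_size.
rewrite inE in ex.
have xU : uniq x by apply: contraNT mux => /(gp_rep muP) ->.
pose z := [tuple of e :: x]; have zU : uniq z by rewrite /= ex.
have z0 : mu (del (ord0 : 'I_r.+1) z) != zerob by rewrite /del /= drop0.
have [X [Xcirc [Xz X0]]] := ex_circuit zU z0.
exists X; split; first exact: circuit_gp_vector Xcirc.
  exists e; have := Xz ord0; rewrite (tnth_nth e) /= => ->.
  by rewrite mulb_neq0 ?sgn_neq0.
move=> b Xb; apply: contraT => bI.
have /tnthP[k bE] : b \in z by apply: contraNT Xb => /X0 ->.
have zk : size (del k z) == r.
  have := perm_size (perm_del b (_ : k < size z)).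
  by rewrite size_tuple ltn_ord => /(_ isT) [<-].
have muk : mu (Tuple zk) != zerob.
  by move: Xb; rewrite bE Xz mulb_eq0 negb_or => /andP[].
have /= := xmax _ muk; rewrite leqNgt => /negP; case.
suff sI : e |: ([set:: x] :&: I) \subset [set:: Tuple zk] :&: I.
  by apply: leq_trans (subset_leq_card sI); rewrite cardsU1 !inE (negPf ex).
apply/subsetP => i; rewrite !inE => ei.
have iI : i \in I by case/predU1P: ei => [->|/andP[]].
have : i \in z by rewrite inE; case/predU1P: ei => [->|/andP[-> _]]; rewrite ?eqxx ?orbT.
rewrite iI andbT (perm_mem (perm_del b (_ : k < size z))) ?size_tuple // inE.
by rewrite -tnth_nth -bE; case/predU1P => // ib; rewrite -ib iI in bI.
Qed.

End Vectors.

(** * Isomorphism invariants of pointed matroids *)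

Section PointedVectors.
Variable F : idyllType.
Implicit Types (M N : pmatroid F).

Definition pgp M (x : seq (pground M)) : F := gp (pmat M) (map Some x).

Lemma pgp_somes M w :
  gp (pmat M) w != zerob -> exists2 x, w = map Some x & pgp x != zerob.
Proof. by move=> w0; have [x xE] := gp_somes w0; exists x; rewrite // /pgp -xE. Qed.

Lemma pgpP M : gp_function (frank (pmat M)) (@pgp M).
Proof.
have := gp_pull (gpP (pmat M)) (gp_del_point M); rewrite subn0.
by congr gp_function; apply/funext => x; rewrite cats0.
Qed.

Lemma pvectorsP M X : pvectors M X <-> gp_vector (frank (pmat M)) (@pgp M) X.
Proof.
apply: iff_trans (vectors_gp_matroid _ _) _.
apply: iff_trans (orth_dualP _ (gp_pull (gpP (pmat M)) (gp_del_point M))) _.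
rewrite subn0.
by split=> XP y /XP; congr null; apply: eq_map => e; rewrite cats0.
Qed.

Lemma hom_iso_supp M N (f : hom M N) (g : hom N M) i :
  comp_hom g f = id_hom M -> exists j, f j i != zerob /\ g i j != zerob.
Proof.
move=> /(congr1 (fun h : hom M M => h i i)) /= gfi.
have [|j gij fji] := @mulmm_neq0 _ _ _ _ g f i i (hom_submonomial g).
  by rewrite gfi /id_mx /delta_mx eqxx oneb_neq0.
by exists j.
Qed.

(** The diagonal entries of g f are 1, so for each i some j has both f j i and
    g i j nonzero; as f and g are submonomial, j is unique and determines i. *)
Lemma isomorphic_match M N : isomorphic M N ->
  exists (f : hom M N) (g : hom N M) (s : pground M -> pground N),
    [/\ injective s, comp_hom f g = id_hom N & forall i j, (g i j != zerob) = (j == s i)].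
Proof.
move=> [f [g [gf fg]]].
have /choice[s sP] i : exists j, f j i != zerob /\ g i j != zerob.
  exact: hom_iso_supp.
exists f, g, s; split=> // [i i' ss|i j].
  by apply: (hom_submonomial f).1 (sP i).1 _; rewrite ss (sP i').1.
apply/idP/eqP => [gij|->]; last exact: (sP i).2.
exact: (hom_submonomial g).1 gij (sP i).2.
Qed.

(** A set of more than [frank N] elements supports a nonzero vector of N, which
    an isomorphism carries to a nonzero vector of M; the support of the latter
    cannot be contained in a basis of M. *)
Lemma isomorphic_frank_le M N : isomorphic M N -> frank (pmat M) <= frank (pmat N).
Proof.
move=> /isomorphic_match[f [g [s [s_inj fg gs]]]]; rewrite leqNgt; apply/negP => NM.
have [x x0] := gp_neq0 (pgpP M).
have xU : uniq x by apply: contraNT x0 => /(gp_rep (pgpP M)) ->.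
have sxN : frank (pmat N) < #|[set:: map s x]|.
  rewrite cardsE (card_uniqP _) ?map_inj_uniq // size_map.
  by rewrite (gp_size (pgpP M) x0).
have [X [XV [j Xj] Xs]] := gp_vector_dependent (pgpP N) sxN.
have gXV : gp_vector (frank (pmat M)) (@pgp M) (mulmv g X).
  by apply/pvectorsP/hom_vectors/pvectorsP.
have gX0 : mulmv g X = fun=> zerob.
  apply/funext; apply: gp_vector_basis (pgpP M) x0 gXV _ => i.
  have gi : g i (s i) != zerob by rewrite gs.
  rewrite (mulmvE _ (hom_submonomial g) gi) mulb_eq0 negb_or => /andP[_ /Xs].
  by rewrite inE (mem_map s_inj).
have : mulmv f (mulmv g X) j = zerob.
  by rewrite gX0; apply: fsum_val0 => i; rewrite mulb0.
rewrite mulmvA; [|exact: hom_submonomial..].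
rewrite -[mulmm f g]/(hom_mx (comp_hom f g)) fg mul1mv => Xj0.
by rewrite Xj0 eqxx in Xj.
Qed.

Lemma isomorphic_frank M N : isomorphic M N -> frank (pmat M) = frank (pmat N).
Proof.
move=> MN; apply/eqP; rewrite eqn_leq.
by rewrite !isomorphic_frank_le //; apply: isomorphic_sym.
Qed.

Lemma isomorphic_card M N : isomorphic M N -> #|pground M| = #|pground N|.
Proof.
move=> MN; apply/eqP; rewrite eqn_leq.
have [f [g [s [s_inj _ _]]]] := isomorphic_match MN.
have [f' [g' [s' [s'_inj _ _]]]] := isomorphic_match (isomorphic_sym MN).
by rewrite (leq_card s) // (leq_card s').
Qed.

End PointedVectors.

(** * Vectors of restrictions and contractions *)

Section Ranks.
Variables (F : idyllType) (E : finType) (M : fmatroid F E).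
Implicit Types (A B I : {set E}) (s w : seq E).

Lemma basis_word w : gp M w != zerob -> basis M [set:: w].
Proof.
move=> w0; have wr : size w == frank M by apply/eqP/(gp_size (gpP M)).
by apply/existsP; exists (Tuple wr); rewrite eqxx.
Qed.

Lemma card_basis B : basis M B -> #|B| = frank M.
Proof.
move=> /existsP[e /andP[/eqP -> e0]].
rewrite cardsE (card_uniqP _) ?size_tuple //.
by apply: contraNT e0 => /(gp_rep (gpP M)) ->.
Qed.

Lemma leq_mrank A w s : gp M w != zerob -> uniq s ->
  {subset s <= w} -> {subset s <= A} -> size s <= mrank M A.
Proof.
move=> w0 sU sw sA; apply: leq_trans (leq_bigmax_cond _ (basis_word w0)).
rewrite -(card_uniqP sU) subset_leq_card //; apply/subsetP => i si.
by rewrite !inE sA //= sw.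
Qed.

Lemma obasis_restrP A : let a := obasis_restr M A in
  [/\ uniq a, {subset a <= A} & size a = mrank M A].
Proof.
rewrite /obasis_restr; set a := xchoose _ => /=.
have /andP[aU] : ordered_basis _ a := xchooseP _.
move=> /existsP[B /and3P[_ /eqP aE /eqP aA]]; split=> // [i ia|].
  by have /setP/(_ i) := aE; rewrite !inE ia; case: (i \in A).
by rewrite -aA cardsE (card_uniqP aU).
Qed.

Lemma size_obasis_contr A : size (obasis_contr M A) + mrank M A = frank M.
Proof.
rewrite /obasis_contr; set c := xchoose _.
have /andP[cU] : ordered_basis _ c := xchooseP _.
move=> /existsP[I /and3P[/existsP[B /and3P[_ /eqP IE /eqP IA]] cA]].
move=> /card_basis <-; rewrite cardsU disjoint_setI0 ?cards0 ?subn0.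
  by rewrite IA cardsE (card_uniqP cU).
by apply: disjointWr cA; rewrite IE subsetIl.
Qed.

End Ranks.

Lemma del_catl (T : Type) k (x y : seq T) :
  k < size x -> del k (x ++ y) = del k x ++ y.
Proof.
move=> kx; rewrite /del take_cat drop_cat kx; case: ltnP => xk; first by rewrite catA.
have -> : k.+1 = size x by apply/eqP; rewrite eqn_leq kx.
by rewrite subnn drop0 drop_size cats0.
Qed.

Lemma mem_del_catl (T : eqType) k (x y : seq T) :
  size x <= k -> {subset x <= del k (x ++ y)}.
Proof.
by move=> xk i ix; rewrite /del take_cat ltnNge xk /= -catA mem_cat ix.
Qed.

Section RestrictionContractionVectors.
Variables (F : idyllType) (M : pmatroid F) (A : {set pground M}).
Local Notation T := (pground M).
Local Notation SA := [set Some x | x in A].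

Lemma frank_contr : frank (pmat (contr A)) + mrank (pmat M) SA = frank (pmat M).
Proof.
have [_ _ szE] := obasis_restrP (pmat M) SA.
by rewrite /= szE subnK // -(size_obasis_contr _ SA) leq_addl.
Qed.

Lemma frank_restr : frank (pmat (restr A)) = mrank (pmat M) SA.
Proof. by rewrite /= -(size_obasis_contr _ SA) addKn. Qed.

(** Both M|A and M/A arise by appending a fixed word; it avoids the base point,
    which is a loop. *)
Lemma pgp_pull (P : pred T) a
    (H : exists x, gp (pmat M) (map (@in_ground T P) x ++ a) != zerob) :
  exists b s, [/\ b != zerob, a = map Some s
    & forall x, pgp (M := PMatroid (pull_pmatP H)) x = b * pgp (map val x ++ s)].
Proof.
have [b b0 bE] := gp_matroidE (gp_pull (gpP (pmat M)) H).
have [w /pgp_somes[x xE _]] := H.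
have aE : a = map Some (drop (size w) x).
  by rewrite map_drop -xE drop_size_cat ?size_map.
exists b, (drop (size w) x); split=> // y.
by rewrite /pgp bE map_cat -aE -!map_comp.
Qed.

Lemma pgp_neq0_uniq x : pgp (M := M) x != zerob -> uniq x.
Proof. by apply: contraNT => /(gp_rep (pgpP M)) ->. Qed.

(** The terms indexed by A vanish, since an ordered basis of M|A followed by a
    further element of A is dependent. *)
Lemma contr_pvectors X : pvectors M X -> pvectors (contr A) (X \o val).
Proof.
move=> /pvectorsP XV; apply/pvectorsP => y yr.
have [b [s [b0 sE gpE]]] := pgp_pull (contr_subproof A).
have [_ aA szE] := obasis_restrP (pmat M) SA; rewrite sE size_map in szE.
have sV : (size (map val y ++ s)).+1 = frank (pmat M).
  by rewrite size_cat size_map szE -addSn yr frank_contr.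
have {XV} := null_scale b (XV _ sV).
rewrite -map_comp -(null_reindex (h := val) (I := pground (contr A))) => [|//|t].
- congr null; apply: eq_map => e /=; rewrite gpE /= mulbCA.
  by congr (_ * (_ * _)).
- exact: val_inj.
rewrite /= !mulb_eq0 !negb_or => /and3P[_ _ t0].
have tA : t \notin A.
  apply: contraL (ltnSn (mrank (pmat M) SA)) => tA; rewrite -leqNgt -{1}szE.
  have := pgp_neq0_uniq t0; rewrite /= cat_uniq mem_cat negb_or.
  case/andP => /andP[_ ts] /and3P[_ _ sU].
  rewrite -(size_map Some) -[_.+1]/(size (Some t :: map Some s)).
  apply: (leq_mrank t0).
  - by rewrite /= mem_map ?map_inj_uniq ?ts // => ? ? [].
  - by move=> i; rewrite /= map_cat !inE mem_cat => /orP[->|->]; rewrite ?orbT.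
  - by move=> i; rewrite inE => /predU1P[->|]; [apply: imset_f | rewrite -sE => /aA].
by exists (Sub t tA).
Qed.

(** For a cocircuit mu (_, y) of M and a circuit of M|A supported in the word z,
    orthogonality is the Grassmann-Pluecker relation for the words (z, c) and y,
    where c is an ordered basis of M/A: omitting an entry of c leaves all of z,
    which has more entries than the rank of A. Hence the cocircuits of M restrict
    to covectors of M|A, and perfection makes them orthogonal to all vectors. *)
Lemma restr_pvectors (X : T -> F) : perfect F ->
  (forall t, X t != zerob -> t \in A) ->
  pvectors (restr A) (X \o val) -> pvectors M X.
Proof.
move=> Fperf XA XV; apply/pvectorsP => y yr.
have [b [c [b0 cE gpE]]] := pgp_pull (restr_subproof A).
apply/(null_reindex (h := val) (I := pground (restr A))) => [|t|].
- exact: val_inj.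
- rewrite mulb_eq0 negb_or => /andP[/XA tA _]; by exists (Sub t tA).
set N := del_point (restr A) in XV *.
suff : covectors N (fun e => pgp (val e :: y)) by apply: Fperf XV.
move=> Z; rewrite /circuits.
have [a a0 ->] := gp_matroidE (gp_pull (gpP (pmat (restr A))) (gp_del_point (restr A))).
move=> /(circuit_scale _ _ _ a0).2[d [z [_ /tuple_uniqP z_inj _ Zz Z0]]].
have NA : frank N = mrank (pmat M) SA by rewrite -frank_restr /= subn0.
have rE : frank (pmat M) = (frank N + size c)%N.
  by rewrite NA -(size_obasis_contr _ SA) cE size_map addnC.
have wr : size (map val z ++ c) == (frank (pmat M)).+1.
  by rewrite size_cat size_map size_tuple rE.
have le_r : (frank N).+1 <= (frank (pmat M)).+1 by rewrite ltnS rE leq_addr.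
have := gp_rel (pgpP M) (Tuple wr) yr.
rewrite -(null_reindex (h := widen_ord le_r)) => [|i j /(congr1 val)/= /val_inj //|j].
  move=> /(null_scale (d * b)); rewrite -map_comp => zV.
  apply/(null_reindex z_inj) => [e|].
    have [/tnthP[k ->]|/Z0 ->] := boolP (e \in z); first by exists k.
    by rewrite mulb0 eqxx.
  congr null: zV; apply: eq_map => k /=.
  have kz : k < size (map val z) by rewrite size_map size_tuple.
  rewrite Zz cats0 -[gp _ _]/(pgp _) gpE -del_map -del_catl //.
  rewrite [tnth (Tuple _) _](tnth_nth (val (tnth z k))) /= nth_cat kz.
  rewrite (nth_map (tnth z k)) ?size_tuple // -tnth_nth.
  by rewrite [RHS]mulbC -!mulgA [b * (sgn F k * _)]mulbCA.
rewrite !mulb_eq0 !negb_or => /and3P[_ j0 _].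
suff jz : j < (frank N).+1 by exists (Ordinal jz); apply: val_inj.
rewrite ltnNge; apply: contraL (ltnSn (frank N)) => zj; rewrite -leqNgt {2}NA.
rewrite -(size_tuple z) -(size_map (Some \o val)).
have zw : {subset map val z <= del j (map val z ++ c)}.
  by apply: mem_del_catl; rewrite size_map size_tuple.
apply: (leq_mrank j0).
- rewrite map_inj_uniq => [|e e' [/val_inj]//]; exact/tuple_uniqP.
- by move=> _ /mapP[e ez ->]; apply: map_f; apply/zw/map_f.
- by move=> _ /mapP[e ez ->]; apply: imset_f; apply: (valP e).
Qed.

End RestrictionContractionVectors.

(** * The short exact sequences, and the matroids with at most one element *)

Section ExactSequences.
Variable F : idyllType.
Implicit Types (M N : pmatroid F).

Lemma mulmm1 (I J : finType) (f : I -> J -> F) : mulmm f (id_mx F J) = f.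
Proof.
apply/funext => i; apply/funext => k.
rewrite /mulmm (@fsum_val1 _ _ (fun j => f i j * id_mx F J j k) k) => [|j].
  by rewrite /id_mx /delta_mx eqxx mulg1.
by rewrite mulb_eq0 negb_or => /andP[_ /id_mx_neq0].
Qed.

Lemma id_hom_iso M : is_iso (id_hom M).
Proof. by exists (id_hom M); rewrite comp1hom. Qed.

Section Subset.
Variables (M : pmatroid F) (A : {set pground M}).

Let restr_mxE t i : @restr_mx F M A t i != zerob -> t = val i.
Proof. by rewrite /restr_mx /delta_mx; case: (t =P val i) => //; rewrite eqxx. Qed.

Let contr_mxE i t : @contr_mx F M A i t != zerob -> val i = t.
Proof. by rewrite /contr_mx /delta_mx; case: (val i =P t) => //; rewrite eqxx. Qed.

Let restr_mx1 i : @restr_mx F M A (val i) i = 1.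
Proof. by rewrite /restr_mx /delta_mx eqxx. Qed.

Let contr_mx1 i : @contr_mx F M A i (val i) = 1.
Proof. by rewrite /contr_mx /delta_mx eqxx. Qed.

Lemma restr_mx_submonomial : submonomial (@restr_mx F M A).
Proof.
by split=> [t i j /restr_mxE -> /restr_mxE/val_inj|i t u /restr_mxE -> /restr_mxE].
Qed.

Lemma contr_mx_submonomial : submonomial (@contr_mx F M A).
Proof.
split=> [i t u /contr_mxE <- /contr_mxE //|t i j /contr_mxE <- /contr_mxE ji].
exact/esym/val_inj.
Qed.

Lemma restr_mx_vectors X : perfect F ->
  pvectors (restr A) X -> pvectors M (mulmv (@restr_mx F M A) X).
Proof.
move=> Fperf XV; apply: (@restr_pvectors _ _ A) => // [t|].
  have [[i]|t0] := row_cases (@restr_mx F M A) t; last by rewrite mulmv0 ?eqxx.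
  by move=> /restr_mxE -> _; apply: (valP i).
congr pvectors: XV; apply/funext => i /=.
rewrite (@mulmvE _ _ _ _ _ _ i) ?restr_mx1 ?mul1g ?oneb_neq0 //.
exact: restr_mx_submonomial.
Qed.

Lemma contr_mx_vectors X :
  pvectors M X -> pvectors (contr A) (mulmv (@contr_mx F M A) X).
Proof.
move=> /(@contr_pvectors _ _ A); congr pvectors; apply/funext => i /=.
rewrite (@mulmvE _ _ _ _ _ _ (val i)) ?contr_mx1 ?mul1g ?oneb_neq0 //.
exact: contr_mx_submonomial.
Qed.

Definition restr_hom (Fperf : perfect F) : hom (restr A) M :=
  Hom restr_mx_submonomial (fun X => @restr_mx_vectors X Fperf).

Definition contr_hom : hom M (contr A) :=
  Hom contr_mx_submonomial contr_mx_vectors.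

Lemma short_exact_restr_contr (Fperf : perfect F) :
  short_exact (restr_hom Fperf) contr_hom.
Proof.
exists M, A, (id_hom _), (id_hom _), (id_hom _).
by split; rewrite ?mul1mm ?mulmm1 //; apply: id_hom_iso.
Qed.

End Subset.

Lemma frank_le_card M : frank (pmat M) <= #|pground M|.
Proof.
have [x x0] := gp_neq0 (pgpP M); rewrite -(gp_size (pgpP M) x0).
by rewrite -(card_uniqP (pgp_neq0_uniq x0)) max_card.
Qed.

Lemma isomorphic_card0 M N :
  #|pground M| = 0%N -> #|pground N| = 0%N -> isomorphic M N.
Proof.
move=> /card0_eq M0 /card0_eq N0.
have zero_hom (P Q : pmatroid F) : pground P =i pred0 -> pground Q =i pred0 -> hom P Q.
  move=> P0 Q0; exists (fun _ _ => zerob) => [|X _].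
    by split=> i; [have := Q0 i | have := P0 i].
  apply/pvectorsP => y _; rewrite (eq_enum Q0) enum0; exact: null0.
exists (zero_hom M N M0 N0), (zero_hom N M N0 M0).
split; apply: hom_eq; apply/funext => i; first by have := M0 i.
by have := N0 i.
Qed.

Definition point_gp (b : bool) (x : seq (option unit)) : F :=
  if x == nseq b (Some tt) then 1 else zerob.

Lemma point_gpP (b : bool) : gp_function b (point_gp b).
Proof.
have gpE x : point_gp b x != zerob -> x = nseq b (Some tt).
  by rewrite /point_gp; case: (x =P _) => //; rewrite eqxx.
split=> [x /gpE ->||x s|x|].
- by rewrite size_nseq.
- by exists (nseq b (Some tt)); rewrite /point_gp eqxx oneb_neq0.
- have -> : s = 1.
    apply/permP => i; apply/val_inj; move: i (s i).
    by case: (b) => [i j|[]//]; rewrite !ord1.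
  rewrite odd_perm1 mul1g; congr point_gp; rewrite -[RHS](map_tnth_enum x).
  by apply: eq_map => i; rewrite perm1.
- by apply: contraNeq => /gpE ->; case: (b).
case: b gpE => [gpE|//] x y [/size0nil ->].
rewrite !enum_ordSl /= enum_ord0 /=.
case: x => -[//|x0 [//|x1 []//]] xr; rewrite !(tnth_nth x0) /del /=.
rewrite mul1g /sgn expg1 [_ [:: x0] * _]mulbC -oppbM; exact/oppbP.
Qed.

Lemma point_pmatP (b : bool) x : None \in x -> gp (gp_matroid (point_gpP b)) x = zerob.
Proof.
have [a _ ->] := gp_matroidE (point_gpP b) => xN.
rewrite /point_gp; case: (x =P _) => [xE|]; last by rewrite mulb0.
by rewrite xE mem_nseq andbF in xN.
Qed.

(** The loop and the coloop: the matroids of rank 0 and 1 on one element. *)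
Definition point (b : bool) : pmatroid F := PMatroid (@point_pmatP b).

Lemma isomorphic_point M :
  #|pground M| = 1%N -> exists b, isomorphic M (point b).
Proof.
move=> M1; have [e eP] := fintype1 M1.
have [b bE] : exists b : bool, frank (pmat M) = b.
  have := frank_le_card M; rewrite M1.
  by case: (frank _) => [|[|//]] _; [exists false | exists true].
have seqE x : size x = b -> map Some x = nseq b (Some e).
  by case: b {bE} x => -[|? [|]] //= _; rewrite eP.
have [x x0] := gp_neq0 (pgpP M); have xE := seqE x (etrans (gp_size (pgpP M) x0) bE).
rewrite /pgp xE in x0; set k := gp (pmat M) _ in x0.
have [k' kk'] := idyll_unit k x0.
have [a a0 aE] := gp_matroidE (point_gpP b).
(* k is the only nonzero value of M; rescaling by a / k turns it into that of
   the representative chosen for [point b]. *)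
exists b; apply: (@isomorphic_rename _ M (point b) (fun=> e) (fun=> tt) _ _ _ _ (a * k')).
- by case.
- by move=> t; rewrite eP.
- apply: (@eq_from_nth _ e) => [|i _]; first by rewrite size_map -!cardE M1 card_unit.
  by rewrite [RHS]eP; apply: eP.
- by rewrite bE.
- apply: mulb_neq0 => //; apply/eqP => k'0.
  by have := @oneb_neq0 F; rewrite -kk' k'0 mulb0 eqxx.
apply/funext => w; rewrite [LHS]/= aE /point_gp.
have [->|wN] := eqVneq w (nseq b (Some tt)).
  by rewrite map_nseq -/k mulg1 -mulgA [k' * k]mulbC kk' mulg1.
rewrite mulb0; apply/esym/eqP; rewrite mulb_eq0; apply/orP; right.
apply: contraNT wN => w0; have [v vE v0] := pgp_somes w0.
have := seqE v (etrans (gp_size (pgpP M) v0) bE); rewrite -vE.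
have -> : nseq b (Some e) = map (omap (fun=> e)) (nseq b (Some tt)).
  by rewrite map_nseq.
by move=> /inj_map -> // [[]|] [[]|].
Qed.

End ExactSequences.

(** * The Grothendieck group *)

Section K0Invariant.
Local Open Scope ring_scope.
Variable F : idyllType.
Implicit Types (M N : pmatroid F).

(** The values are in int^o, the group of integers viewed as a module over
    itself, because [fglift] extends maps into modules. *)
Definition rank_corank M : int^o * int^o :=
  ((frank (pmat M))%:Z, #|pground M|%:Z - (frank (pmat M))%:Z).

Lemma rank_corank_iso M N : isomorphic M N -> rank_corank M = rank_corank N.
Proof.
by move=> MN; rewrite /rank_corank (isomorphic_frank MN) (isomorphic_card MN).
Qed.

Lemma rank_corank_split M (A : {set pground M}) :
  rank_corank M = rank_corank (restr A) + rank_corank (contr A).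
Proof.
have cardE : #|pground M| = (#|pground (restr A)| + #|pground (contr A)|)%N.
  by rewrite /= !card_sig; apply/esym/cardC.
rewrite /rank_corank cardE -(frank_contr A) frank_restr /=.
by rewrite [(_ + mrank _ _)%N]addnC !PoszD opprD addrACA.
Qed.

Definition class_rep (c : isoclass F) : pmatroid F := sval (cid (class_of_onto c)).

Definition rank_corank_free : {freeg isoclass F} -> int^o * int^o :=
  fglift (fun c => rank_corank (class_rep c)).

HB.instance Definition _ := GRing.isZmodMorphism.Build _ _ rank_corank_free
  (lift_is_additive (fun c => rank_corank (class_rep c))).

Lemma rank_corank_gen M : rank_corank_free (gen M) = rank_corank M.
Proof.
rewrite /rank_corank_free liftU scale1r; apply: rank_corank_iso; apply/class_ofP.
by rewrite /class_rep; case: cid.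
Qed.

(** The kernel is a subgroup and contains the generating relations. *)
Lemma rank_corank_rel z : z \in @k0_rel F -> rank_corank_free z = 0.
Proof.
move=> /asboolP zP; apply/eqP; apply: (zP [pred z | rank_corank_free z == 0]).
  split=> [|x y]; rewrite !inE ?raddf0 //.
  by move=> /eqP x0 /eqP y0; rewrite raddfB /= x0 y0 subr0.
move=> U X V i p [M [A [u [x [v [uI xI vI _ _]]]]]].
rewrite inE raddfB raddfD /= !rank_corank_gen.
rewrite (rank_corank_iso (ex_intro _ u uI)) (rank_corank_iso (ex_intro _ x xI)).
by rewrite (rank_corank_iso (ex_intro _ v vI)) -rank_corank_split subrr.
Qed.

Definition k0_class : {freeg isoclass F} -> K0 F := \pi_(Quotient.quot (@k0_rel F))%qT.

HB.instance Definition _ := GRing.isZmodMorphism.Build _ (K0 F) k0_class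
  (@pi_is_zmod_morphism _ _ _ (Quotient.quot (@k0_rel F))).

Definition rank_corank_k0 (x : K0 F) : int * int :=
  rank_corank_free (generic_quotient.repr (x : Quotient.quot (@k0_rel F))).

Lemma k0_class_onto x : exists z, k0_class z = x.
Proof.
by exists (generic_quotient.repr (x : Quotient.quot (@k0_rel F))); apply: reprK.
Qed.

Lemma rank_corank_class z : rank_corank_k0 (k0_class z) = rank_corank_free z.
Proof.
apply/eqP; rewrite -subr_eq0; apply/eqP; rewrite -raddfB.
by apply: rank_corank_rel; rewrite Quotient.idealrBE reprK.
Qed.

Lemma rank_corank_k0_is_additive : zmod_morphism rank_corank_k0.
Proof.
move=> x y; have [[a <-] [b <-]] := (k0_class_onto x, k0_class_onto y).
by rewrite -raddfB !rank_corank_class raddfB.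
Qed.

HB.instance Definition _ := GRing.isZmodMorphism.Build (K0 F) (int * int)%type
  rank_corank_k0 rank_corank_k0_is_additive.

Lemma k0_class_split (Fperf : perfect F) M (A : {set pground M}) :
  k0_class (gen M) = k0_class (gen (restr A)) + k0_class (gen (contr A)).
Proof.
rewrite -raddfD; apply/eqP; rewrite -Quotient.idealrBE; apply/asboolP => S _.
by apply; apply: short_exact_restr_contr.
Qed.

Lemma k0_class_iso M N :
  isomorphic M N -> k0_class (gen M) = k0_class (gen N).
Proof. by move=> /class_ofP MN; rewrite /gen MN. Qed.

Definition k0_of_pair (p : int * int) : K0 F :=
  k0_class (gen (point F true)) *~ p.1 + k0_class (gen (point F false)) *~ p.2.

Lemma k0_of_pair_is_additive : zmod_morphism k0_of_pair.
Proof.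
move=> p q; rewrite /k0_of_pair /= !mulrzBr opprD !addrA; congr (_ + _).
by rewrite addrAC.
Qed.

HB.instance Definition _ := GRing.isZmodMorphism.Build _ _
  k0_of_pair k0_of_pair_is_additive.

(** Removing one element e splits off M|e, which is a loop or a coloop. For M
    without elements, the sequence of the empty subset reads [M] = [M] + [M]. *)
Lemma k0_of_pair_rank_corank (Fperf : perfect F) M :
  k0_of_pair (rank_corank M) = k0_class (gen M).
Proof.
have pointE b : k0_of_pair (rank_corank (point F b)) = k0_class (gen (point F b)).
  rewrite /k0_of_pair /rank_corank /= card_unit.
  by case: b; rewrite ?subrr ?subr0 !mulr0z !mulr1z ?addr0 ?add0r.
have [n] := ubnP #|pground M|; elim: n M => // n IHn M Mn.
have card_split (A : {set pground M}) :
    (#|pground (restr A)| + #|pground (contr A)|)%N = #|pground M|.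
  by rewrite /= !card_sig; apply: cardC.
have [M0|] := posnP #|pground M|.
  have := k0_class_split Fperf (set0 : {set pground M}).
  have /eqP := card_split set0; rewrite M0 addn_eq0 => /andP[/eqP R0 /eqP C0].
  rewrite -(k0_class_iso (isomorphic_card0 M0 R0)).
  rewrite -(k0_class_iso (isomorphic_card0 M0 C0)).
  rewrite -[LHS]addr0 => /addrI <-.
  have /eqP r0 : frank (pmat M) == 0%N by rewrite -leqn0 -M0 frank_le_card.
  by rewrite /rank_corank M0 r0 subr0 raddf0.
case/card_gt0P=> e _; pose A := [set e].
have R1 : #|pground (restr A)| = 1%N by rewrite /= card_sig -(cards1 e); apply: eq_card.
rewrite (k0_class_split Fperf A) (rank_corank_split A) raddfD /=.
rewrite (IHn (contr A)); last first.
  by move: Mn; rewrite -(card_split A) R1 add1n ltnS.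
have [b RP] := isomorphic_point R1.
by rewrite (rank_corank_iso RP) pointE (k0_class_iso RP).
Qed.

Lemma k0_of_pairK : cancel k0_of_pair rank_corank_k0.
Proof.
have pointE b :
    rank_corank_k0 (k0_class (gen (point F b))) = ((b : nat)%:Z, 1 - (b : nat)%:Z).
  by rewrite rank_corank_class rank_corank_gen /rank_corank /= card_unit.
move=> [m n]; rewrite /k0_of_pair raddfD !raddfMz /= !pointE.
rewrite [LHS]surjective_pairing; congr pair; rewrite raddfD.
  by rewrite !(raddfMz fst) /= (intz m) mul0rz addr0.
by rewrite !(raddfMz snd) /= subrr subr0 intz mul0rz add0r.
Qed.

Lemma rank_corank_k0K (Fperf : perfect F) : cancel rank_corank_k0 k0_of_pair.
Proof.
move=> x; have [z <-] := k0_class_onto x; rewrite rank_corank_class.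
rewrite -[z]freeg_sumE !raddf_sum; apply: eq_bigr => c _ /=.
have [M <-] := class_of_onto c; set k := coeff _ _.
have -> : << k *g class_of M >> = gen M *~ k by rewrite /gen freegU_mulz intz.
by rewrite !raddfMz /= rank_corank_gen k0_of_pair_rank_corank.
Qed.

End K0Invariant.

Theorem proposition5p4 (F : idyllType) (F_perfect : perfect F) :
  exists f : {additive K0 F -> int * int}, bijective f.
Proof.
exists (@rank_corank_k0 F).
exact: Bijective (rank_corank_k0K F_perfect) (@k0_of_pairK F).
Qed.
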